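(* Let $k\ge1$ be an integer, $\lambda_1,\lambda_2>0$ and $0<\alpha\le1$. The fractional Skellam process of order $k$, $\{\mathcal{S}^{k}_{\alpha}(t)\}_{t\ge0}$, with parameters $\lambda_1,\lambda_2,\alpha$ has the long-range dependence (LRD) property.
   Context: Poisson process of order $k$ (PPoK) with intensity $\lambda>0$: $N^k(t)=\sum_{i=1}^{N(t)}X_i$, where $\{N(t)\}_{t\ge0}$ is a Poisson process with intensity $k\lambda$, and $\{X_i\}_{i\ge1}$ are iid, uniform on $\{1,2,\dots,k\}$, and independent of $\{N(t)\}_{t\ge0}$. Skellam process of order $k$ (SPoK): $S^k(t)=N_1^k(t)-N_2^k(t)$, where $\{N_1^k(t)\}_{t\ge0}$ and $\{N_2^k(t)\}_{t\ge0}$ are independent PPoK with intensities $\lambda_1>0$ and $\lambda_2>0$, respectively. Inverse stable subordinator: for $0<\alpha<1$, the stable subordinator $\{D_\alpha(t)\}_{t\ge0}$ is the subordinator with $\mathbb{E}(e^{-sD_\alpha(t)})=e^{-ts^\alpha}$, $s>0$, and $Y_\alpha(t)=\inf\{r\ge0: D_\alpha(r)>t\}$, $t\ge 0$. Fractional Skellam process of order $k$ (FSPoK): $\mathcal{S}^k_\alpha(t)=S^k(Y_\alpha(t))$ for $0<\alpha<1$, where $\{Y_\alpha(t)\}_{t\ge0}$ is independent of $\{S^k(t)\}_{t\ge0}$, and $\mathcal{S}^k_1(t)=S^k(t)$ for $\alpha=1$. LRD property: a stochastic process $\{X(t)\}_{t\ge0}$ has the LRD property if there is $\gamma\in(0,1)$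 such that for every fixed $s>0$ $$\lim_{t\to\infty}\frac{\operatorname{Cov}(X(s),X(t))}{\sqrt{\operatorname{Var}(X(s))}\sqrt{\operatorname{Var}(X(t))}\,t^{-\gamma}}=c(s)$$ for some finite nonzero constant $c(s)$ depending only on $s$. *)

(* Defs.v *)
From HB Require Import structures.
From mathcomp Require Import all_boot all_order all_algebra.
From mathcomp Require Import finmap.
From mathcomp Require Import all_classical all_reals all_analysis.

Set Implicit Arguments.
Unset Strict Implicit.
Unset Printing Implicit Defensive.

Import Order.TTheory GRing.Theory Num.Theory.
Import numFieldNormedType.Exports.

Local Open Scope classical_set_scope.
Local Open Scope ring_scope.

(* A continuous-time process {X(t)}_{t >= 0} is a function X : R -> T -> U; its
   values at negative times are never used. *)

Section independence.
Context {R : realType} {d : measure_display} {T : measurableType d}.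
Variable P : probability T R.

(* sigma(X_i, i in A) *)
Definition sigma_of {d' : measure_display} {U : measurableType d'} {I : Type}
    (A : set I) (X : I -> T -> U) : set (set T) :=
  <<s \bigcup_(i in A) preimage_set_system setT (X i) measurable >>.

Definition independent (F G : set (set T)) : Prop :=
  forall A B, F A -> G B -> P (A `&` B) = (P A * P B)%E.

Definition independent_processes {d1 d2 : measure_display}
    {U1 : measurableType d1} {U2 : measurableType d2}
    (X : R -> T -> U1) (Y : R -> T -> U2) : Prop :=
  independent (sigma_of [set t | 0 <= t] X) (sigma_of [set t | 0 <= t] Y).

Definition mutually_independent {d' : measure_display} {U : measurableType d'}
    {I : choiceType} (X : I -> T -> U) : Prop :=
  forall (J : {fset I}) (B : I -> set U),
    (forall i, i \in J -> measurable (B i)) ->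
    P (\bigcap_(i in [set` J]) (X i @^-1` B i)) =
    (\prod_(i <- J) P (X i @^-1` B i))%E.

(* An infinite nondecreasing sequence of times covers every finite one, by
   repeating the last time. *)
Definition independent_increments (X : R -> T -> R) : Prop :=
  forall t : nat -> R, 0 <= t 0%N -> {homo t : m n / (m <= n)%N >-> m <= n} ->
    mutually_independent (fun n w => X (t n.+1) w - X (t n) w).

Definition stationary_increments (X : R -> T -> R) : Prop :=
  forall s t : R, 0 <= s -> s <= t -> forall B : set R, measurable B ->
    P [set w | B (X t w - X s w)] = P [set w | B (X (t - s) w)].

End independence.

Section processes.
Context {R : realType} {d : measure_display} {T : measurableType d}.
Variable P : probability T R.

(* The path properties hold for every outcome, so that X composed with a random
   time is again a random variable even if P is not complete. Left limits exist
   by monotonicity. *)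
Record subordinator (X : R -> T -> R) : Prop := Subordinator {
  subordinator_measurable : forall t : R, 0 <= t -> measurable_fun setT (X t) ;
  subordinator0 : forall w, X 0 w = 0 ;
  subordinator_nondecreasing : forall w (s t : R), 0 <= s -> s <= t -> X s w <= X t w ;
  subordinator_right_continuous :
    forall w (t : R), 0 <= t -> X u w @[u --> t^'+] --> X t w ;
  subordinator_independent_increments : independent_increments P X ;
  subordinator_stationary_increments : stationary_increments P X }.

Definition poisson_process (lambda : R) (N : R -> T -> nat) : Prop :=
  subordinator (fun t w => (N t w)%:R) /\
  forall (t : R) n, 0 < t -> P (N t @^-1` [set n]) = (poisson_pmf (lambda * t) n)%:E.

Definition PPoK (k : nat) (lambda : R) (M : R -> T -> nat) : Prop :=
  exists (N : R -> T -> nat) (X : nat -> T -> nat),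
    [/\ poisson_process (k%:R * lambda) N,
        (forall i, measurable_fun setT (X i)) /\ mutually_independent P X,
        forall i j, (1 <= j <= k)%N -> P (X i @^-1` [set j]) = (k%:R^-1)%:E,
        independent P (sigma_of [set t | 0 <= t] N) (sigma_of setT X) &
        forall (t : R) w, 0 <= t -> M t w = (\sum_(i < N t w) X i w)%N].

Definition SPoK (k : nat) (lambda1 lambda2 : R) (S : R -> T -> R) : Prop :=
  exists M1 M2 : R -> T -> nat,
    [/\ PPoK k lambda1 M1, PPoK k lambda2 M2,
        independent_processes P M1 M2 &
        forall (t : R) w, 0 <= t -> S t w = (M1 t w)%:R - (M2 t w)%:R].

Definition stable_subordinator (alpha : R) (D : R -> T -> R) : Prop :=
  subordinator D /\
  forall s t : R, 0 < s -> 0 <= t ->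
    'E_P[fun w => expR (- s * D t w)]%E = (expR (- t * s `^ alpha))%:E.

(* The library's [inf set0] is 0; the set is nonempty for almost every w when D
   is a stable subordinator. *)
Definition first_passage (D : R -> T -> R) (t : R) (w : T) : R :=
  inf [set r | 0 <= r /\ t < D r w].

Definition FSPoK (k : nat) (lambda1 lambda2 alpha : R) (Z : R -> T -> R) : Prop :=
  (alpha = 1 /\ SPoK k lambda1 lambda2 Z) \/
  (0 < alpha < 1 /\
   exists S D : R -> T -> R,
     [/\ SPoK k lambda1 lambda2 S, stable_subordinator alpha D,
         independent_processes P (first_passage D) S &
         forall (t : R) w, 0 <= t -> Z t w = S (first_passage D t w) w]).

(* Square integrability is what makes the covariances and variances
   meaningful: the library's integral and [fine] are total. *)
Definition LRD (X : R -> T -> R) : Prop :=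
  (forall t : R, 0 <= t -> X t \in Lfun P 2%:E) /\
  exists2 gamma : R, 0 < gamma < 1 &
  exists c : R -> R, forall s : R, 0 < s ->
    c s != 0 /\
    fine (covariance P (X s) (X t)) /
      (Num.sqrt (fine 'V_P[X s]) * Num.sqrt (fine 'V_P[X t]) * t `^ (- gamma))
    @[t --> +oo] --> c s.

End processes.

(* Main.v *)
Require Import Defs.
From HB Require Import structures.
From mathcomp Require Import all_boot all_order all_algebra.
From mathcomp Require Import finmap.
From mathcomp Require Import all_classical all_reals all_analysis.
From mathcomp Require Import measurable_realfun ring lra.

Import Order.TTheory GRing.Theory Num.Theory.
Import numFieldNormedType.Exports.

Set Implicit Arguments.
Unset Strict Implicit.
Unset Printing Implicit Defensive.

Local Open Scope classical_set_scope.
Local Open Scope ring_scope.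

(** Let [S] be the Skellam process of order [k] and [Y] the first passage
    process of the stable subordinator [D].  The compound sums and the
    difference of two Poisson processes have moments E S_t = m t and
    Cov (S_s, S_t) = v min (s, t) with [v > 0] ([SPoK_levy_moments]), and
    conditioning on the independent time change gives, for s <= t,
      Cov (Z_s, Z_t) = v E Y_s + m^2 Cov (Y_s, Y_t)
    ([subordination_covariance]).  The theorem thus rests on three facts
    about [Y] when [alpha < 1].

    - Powers.  The Laplace transforms of [D (x^alpha r)] and [x D r] agree,
      so these variables have the same law (compared by [laplace_cdf_le]); hence [Y] at time [x t] is distributed as [x^alpha] times
      [Y] at time [t], and E Y_t = c1 t^alpha, E Y_t^2 = c2 t^(2 alpha).

    - Covariance.  Since [Y_t] is the length of the set of the [r] with
      D r <= t, the moment E Y_s Y_t is the double integral of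
      P (D r <= s, D r' <= t).  Where r' <= r the second event contains the
      first one, which contributes E Y_s^2 / 2; where r' >= r the increment
      D r' - D r is independent of D r and has to stay below a level between
      t - s and t, which contributes between E Y_s E Y_(t-s) and E Y_s E Y_t.
      As t^alpha - (t - s)^alpha vanishes at infinity, Cov (Y_s, Y_t) tends to
      E Y_s^2 / 2 ([first_passage_covariance_cvg]).  The integrals are
      replaced by sums over grids of mesh [delta], at the cost of errors that
      vanish with [delta] ([moment_product_le], [moment_product_ge]).

    - Nondegeneracy.  If [Y_t] had variance 0, its covariances would vanish by
      the Cauchy-Schwarz inequality and could not tend to E Y_t^2 / 2 > 0.

    Hence Cov (Z_s, Z_t) tends to a positive constant as [t] grows, whereas
    Var Z_t is of order [t] when [alpha = 1], of order t^alpha when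
    [alpha < 1] and [m = 0], and of order t^(2 alpha) when [alpha < 1] and
    [m <> 0]; the exponent [gamma] is half the one of the variance. *)

(** * Independent maps and Fubini's theorem *)

Definition independent_maps {R : realType} {d d1 d2 : measure_display}
    {T : measurableType d} {U1 : measurableType d1} {U2 : measurableType d2}
    (P : probability T R) (X : T -> U1) (X' : T -> U2) : Prop :=
  forall A B, measurable A -> measurable B ->
  P (X @^-1` A `&` X' @^-1` B) = (P (X @^-1` A) * P (X' @^-1` B))%E.

(** No integrability is assumed: the change of variables holds separately for
    the positive and the negative part of [f], whatever their integrals. *)
Lemma integral_law {R : realType} {d d' : measure_display}
    {T : measurableType d} {U : measurableType d'} (P : probability T R)
    (X : {mfun T >-> U}) (f : U -> \bar R) : measurable_fun [set: U] f ->
  (\int[distribution P X]_y f y = \int[P]_w f (X w))%E.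
Proof.
move=> mf; rewrite integralE [RHS]integralE; congr (_ - _)%E.
- rewrite ge0_integral_distribution//; last exact: measurable_funepos.
  by apply: eq_integral => w _; rewrite -funepos_comp.
- rewrite ge0_integral_distribution//; last exact: measurable_funeneg.
  by apply: eq_integral => w _; rewrite -funeneg_comp.
Qed.

Section integral_independent.
Local Open Scope ereal_scope.
Context {R : realType} {d d1 d2 : measure_display} {T : measurableType d}
  {U1 : measurableType d1} {U2 : measurableType d2}.
Variables (P : probability T R) (X : T -> U1) (X' : T -> U2).
Hypotheses (mX : measurable_fun setT X) (mX' : measurable_fun setT X').
Hypothesis XX' : independent_maps P X X'.

Let fX : {mfun T >-> U1} := mfun_Sub (mem_set mX).
Let fX' : {mfun T >-> U2} := mfun_Sub (mem_set mX').
Let pair w := (X w, X' w).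
Let mpair : measurable_fun setT pair.
Proof. exact: measurable_fun_pair. Qed.
Let fpair : {mfun T >-> (U1 * U2)%type} := mfun_Sub (mem_set mpair).

Let law_pair A : measurable A ->
  (distribution P fX \x distribution P fX') A = distribution P fpair A.
Proof.
by apply: product_measure_unique => B C mB mC; exact: XX'.
Qed.

Let integral_pair (h : U1 * U2 -> \bar R) :
  \int[distribution P fX \x distribution P fX']_z h z =
  \int[distribution P fpair]_z h z.
Proof. by apply: eq_measure_integral => A mA _; exact: law_pair. Qed.

(** By independence the law of the pair is the product of the laws, to which
    Tonelli's theorem applies. *)
Lemma ge0_integral_independent (h : U1 * U2 -> \bar R) :
  measurable_fun [set: U1 * U2] h -> (forall x, 0 <= h x) ->
  \int[P]_w h (X w, X' w) = \int[P]_w \int[P]_w' h (X w, X' w').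
Proof.
move=> mh h0.
transitivity (\int[distribution P fpair]_z h z).
  by rewrite ge0_integral_distribution.
rewrite -integral_pair fubini_tonelli1// ge0_integral_distribution//; last 2 first.
- exact: measurable_fun_fubini_tonelli_F.
- by move=> x; apply: integral_ge0.
apply: eq_integral => w _ /=; rewrite /fubini_F ge0_integral_distribution//.
exact: measurableT_comp.
Qed.

Lemma integral_independent (h : U1 * U2 -> \bar R) :
  measurable_fun [set: U1 * U2] h ->
  P.-integrable setT (fun w => h (X w, X' w)) ->
  \int[P]_w h (X w, X' w) = \int[P]_w \int[P]_w' h (X w, X' w').
Proof.
move=> mh ih.
have ihp : (distribution P fX \x distribution P fX')%E.-integrable setT h.
  apply/integrableP; split => //.
  rewrite integral_pair integral_law; last exact: measurableT_comp.
  by have /integrableP[] := ih.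
transitivity (\int[distribution P fpair]_z h z); first by rewrite integral_law.
rewrite -integral_pair -integral12_prod_meas1// integral_law; last first.
  exact: (measurable_fubini_F ihp).
apply: eq_integral => w _; rewrite /fubini_F integral_law//.
exact: measurableT_comp.
Qed.

End integral_independent.

(** * Square integrable functions *)

Section square_integrable.
Context {R : realType} {d : measure_display} {T : measurableType d}.
Variable P : probability T R.

Lemma Lfun2_sqr_integrable (f : T -> R) : measurable_fun setT f ->
  (\int[P]_w (f w ^+ 2)%:E < +oo)%E -> f \in Lfun P 2%:E.
Proof.
move=> mf f2; rewrite inE; apply/andP; split; rewrite inE//=.
rewrite /finite_norm unlock /= poweR_lty//.
apply: le_lt_trans f2; rewrite le_eqVlt; apply/orP; left; apply/eqP.
by apply: eq_integral => w _ /=; rewrite powR_mulrn// real_normK// num_real.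
Qed.

Lemma Lfun_measurable (p : \bar R) (f : T -> R) :
  f \in Lfun P p -> measurable_fun setT f.
Proof. by rewrite inE => /andP[]; rewrite inE. Qed.

Lemma Lfun21 (f : T -> R) : f \in Lfun P 2%:E -> f \in Lfun P 1.
Proof. by apply: Lfun_subset12; exact: fin_num_measure. Qed.

Lemma Lfun2B (f g : T -> R) : f \in Lfun P 2%:E -> g \in Lfun P 2%:E ->
  (fun w => f w - g w) \in Lfun P 2%:E.
Proof. by move=> f2 g2; apply: rpredB => //; rewrite lee1n. Qed.

Lemma Lfun1_EFin (f : T -> R) : f \in Lfun P 1 ->
  'E_P[f]%E = (fine 'E_P[f]%E)%:E.
Proof. by move=> fP; rewrite fineK// expectation_fin_num. Qed.

Lemma Lfun2_covE (f g : T -> R) : f \in Lfun P 2%:E -> g \in Lfun P 2%:E ->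
  covariance P f g = ('E_P[f \* g] - 'E_P[f] * 'E_P[g])%E.
Proof.
move=> f2 g2; have fg := Lfun2_mul_Lfun1 f2 g2.
by rewrite covarianceE//; exact: Lfun21.
Qed.

Lemma expectationM_covariance (f g : T -> R) (a b c : R) :
  f \in Lfun P 2%:E -> g \in Lfun P 2%:E ->
  'E_P[f]%E = a%:E -> 'E_P[g]%E = b%:E -> covariance P f g = c%:E ->
  'E_P[f \* g]%E = (c + a * b)%:E.
Proof.
move=> f2 g2 fa gb; rewrite Lfun2_covE// fa gb => /eqP.
rewrite sube_eq; last 2 first.
- by rewrite expectation_fin_num// Lfun2_mul_Lfun1.
- by rewrite fin_num_adde_defl// fin_numM.
by move/eqP->; rewrite -EFinM -EFinD.
Qed.

Lemma Lfun1_bounded (f : T -> R) (c : R) : measurable_fun setT f ->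
  (forall w, `|f w| <= c) -> f \in Lfun P 1.
Proof.
move=> mf fc; apply/Lfun1_integrable.
apply: (@le_integrable _ _ _ _ _ measurableT _ (EFin \o cst c)).
- exact/measurable_EFinP.
- by move=> w _; rewrite /= lee_fin (le_trans (fc w))// ler_norm.
- by apply/Lfun1_integrable; exact: Lfun_cst.
Qed.

Lemma Lfun1_indic (A : set T) : measurable A -> (\1_A : T -> R) \in Lfun P 1.
Proof.
move=> mA; apply: (@Lfun1_bounded _ 1); first exact: measurable_indic.
by move=> w; rewrite indicE; case: (_ \in _); rewrite ?normr1 ?normr0.
Qed.

Lemma measurable_sublevel (f : T -> R) t : measurable_fun setT f ->
  measurable [set w | f w <= t].
Proof.
move=> mf; rewrite [X in measurable X](_ : _ = f @^-1` `]-oo, t]).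
  by rewrite -[X in measurable X]setTI; exact: mf.
by apply/seteqP; split=> w; rewrite /= in_itv.
Qed.

End square_integrable.

(** * Time change by an independent random time *)

(** The process [S] is read off the source of randomness [X] at the random
    times [tau] and [tau']; the index set [J] is [nat] for the compound sums
    that define the processes of order [k], and the real line for the
    fractional process. *)
Section subordination.
Context {R : realType} {d dJ dU : measure_display} {T : measurableType d}
  {J : measurableType dJ} {U : measurableType dU}.
Variables (P : probability T R) (X : T -> U).
Variables (dom : set J) (time : J -> R) (S : J -> U -> R) (m v : R).
Hypothesis mX : measurable_fun setT X.
Hypothesis mtime : measurable_fun setT time.
Hypothesis mS : measurable_fun [set: J * U] (fun z => S z.1 z.2).
Hypothesis S_mean : forall a, dom a -> 'E_P[S a \o X]%E = (m * time a)%:E.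
Hypothesis S_moment2 : forall a b, dom a -> dom b -> time a <= time b ->
  'E_P[(S a \o X) \* (S b \o X)]%E = (v * time a + m ^+ 2 * (time a * time b))%:E.
Variables tau tau' : T -> J.
Hypotheses (mtau : measurable_fun setT tau) (mtau' : measurable_fun setT tau').
Hypotheses (tau_dom : forall w, dom (tau w)) (tau'_dom : forall w, dom (tau' w)).
Hypothesis tau_le : {ae P, forall w, time (tau w) <= time (tau' w)}.
Hypotheses (tau2 : time \o tau \in Lfun P 2%:E)
  (tau'2 : time \o tau' \in Lfun P 2%:E).
Hypothesis tauX : independent_maps P (fun w => (tau w, tau' w)) X.

Let Z w := S (tau w) (X w).
Let Z' w := S (tau' w) (X w).
Let mtt : measurable_fun setT (fun w => (tau w, tau' w)).
Proof. exact: measurable_fun_pair. Qed.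

Let mS1 : measurable_fun [set: (J * J) * U] (fun z => S z.1.1 z.2).
Proof.
exact: (measurableT_comp mS (measurable_fun_pair
  (measurableT_comp measurable_fst measurable_fst) measurable_snd)).
Qed.

Let mS2 : measurable_fun [set: (J * J) * U] (fun z => S z.1.2 z.2).
Proof.
exact: (measurableT_comp mS (measurable_fun_pair
  (measurableT_comp measurable_snd measurable_fst) measurable_snd)).
Qed.

Let mZ : measurable_fun setT Z.
Proof. exact: (measurableT_comp mS (measurable_fun_pair mtau mX)). Qed.

Let mZ' : measurable_fun setT Z'.
Proof. exact: (measurableT_comp mS (measurable_fun_pair mtau' mX)). Qed.

Let iS_mean a : dom a -> (\int[P]_w (S a (X w))%:E)%E = (m * time a)%:E.
Proof. by move=> /S_mean; rewrite unlock. Qed.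

Let iS_moment2 a b : dom a -> dom b -> time a <= time b ->
  (\int[P]_w (S a (X w) * S b (X w))%:E)%E =
  (v * time a + m ^+ 2 * (time a * time b))%:E.
Proof. by move=> da db /(S_moment2 da db); rewrite unlock. Qed.

Let sqr_lty (t : T -> J) : measurable_fun setT t -> (forall w, dom (t w)) ->
  time \o t \in Lfun P 2%:E ->
  (\int[P]_w \int[P]_w' ((S (t w) (X w')) ^+ 2)%:E < +oo)%E.
Proof.
move=> mt td t2.
under eq_integral => w _.
  under eq_integral do rewrite expr2.
  rewrite iS_moment2//.
  over.
have tt := Lfun2_mul_Lfun1 t2 t2.
have fi : P.-integrable setT
    (EFin \o ((v \o* (time \o t)) \+ (m ^+ 2 \o* ((time \o t) \* (time \o t))))).
  apply/Lfun1_integrable; apply: rpredD; apply: Lfun_scale => //.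
  exact: Lfun21.
have /fin_numPlt/andP[_] := integrable_fin_num measurableT fi.
apply: le_lt_trans.
rewrite le_eqVlt; apply/orP; left; apply/eqP.
by apply: eq_integral => w _ /=; congr (_%:E); ring.
Qed.

Lemma subordination_Lfun2 : Z \in Lfun P 2%:E /\ Z' \in Lfun P 2%:E.
Proof.
split; apply: Lfun2_sqr_integrable => //.
- rewrite (ge0_integral_independent mtt mX tauX
    (h := fun z => (S z.1.1 z.2 ^+ 2)%:E)) ?sqr_lty//.
  + by apply/measurable_EFinP/measurable_funX.
  + by move=> z; rewrite lee_fin sqr_ge0.
- rewrite (ge0_integral_independent mtt mX tauX
    (h := fun z => (S z.1.2 z.2 ^+ 2)%:E)) ?sqr_lty//.
  + by apply/measurable_EFinP/measurable_funX.
  + by move=> z; rewrite lee_fin sqr_ge0.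
Qed.

Lemma subordination_mean : 'E_P[Z]%E = (m%:E * 'E_P[time \o tau])%E.
Proof.
have [Z2 _] := subordination_Lfun2.
rewrite -expectationZl ?Lfun21// unlock.
rewrite (integral_independent mtt mX tauX (h := fun z => (S z.1.1 z.2)%:E)).
- by apply: eq_integral => w _ /=; rewrite iS_mean// mulrC.
- exact/measurable_EFinP.
- exact/Lfun1_integrable/Lfun21.
Qed.

Let mean' : 'E_P[Z']%E = (m%:E * 'E_P[time \o tau'])%E.
Proof.
have [_ Z2] := subordination_Lfun2.
rewrite -expectationZl ?Lfun21// unlock.
rewrite (integral_independent mtt mX tauX (h := fun z => (S z.1.2 z.2)%:E)).
- by apply: eq_integral => w _ /=; rewrite iS_mean// mulrC.
- exact/measurable_EFinP.
- exact/Lfun1_integrable/Lfun21.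
Qed.

(** Conditionally on the times, E [Z Z'] = v tau + m^2 tau tau'. *)
Lemma subordination_covariance : covariance P Z Z' =
  (v%:E * 'E_P[time \o tau] +
   (m ^+ 2)%:E * covariance P (time \o tau) (time \o tau'))%E.
Proof.
have [Z2 Z'2] := subordination_Lfun2.
rewrite !Lfun2_covE// subordination_mean mean'.
have ZZ' : 'E_P[Z \* Z']%E = (v%:E * 'E_P[time \o tau] +
   (m ^+ 2)%:E * 'E_P[(time \o tau) \* (time \o tau')])%E.
  have t1 := Lfun21 tau2; have tt := Lfun2_mul_Lfun1 tau2 tau'2.
  rewrite -!expectationZl// -expectationD; [|exact: Lfun_scale..].
  rewrite unlock.
  rewrite (integral_independent mtt mX tauX
    (h := fun z => (S z.1.1 z.2 * S z.1.2 z.2)%:E)).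
  - transitivity (\int[P]_w (v * Num.min (time (tau w)) (time (tau' w)) +
        m ^+ 2 * (time (tau w) * time (tau' w)))%:E)%E.
      apply: eq_integral => w _ /=; case: leP => [le_tt'|/ltW le_t't].
        by rewrite iS_moment2.
      under eq_integral do rewrite mulrC.
      by rewrite iS_moment2// [X in m ^+ 2 * X]mulrC.
    have mt := measurableT_comp mtime mtau; have mt' := measurableT_comp mtime mtau'.
    apply: ae_eq_integral => //.
    + apply/measurable_EFinP/measurable_funD; apply: measurable_funM => //.
        exact: measurable_minr.
      exact: measurable_funM.
    + apply/measurable_EFinP/measurable_funD; apply: measurable_funM => //.
      exact: measurable_funM.
    + apply: filterS tau_le => w le_tt' _ /=; rewrite (min_idPl le_tt').
      by congr (_%:E); ring.
  - exact/measurable_EFinP/measurable_funM.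
  - by apply/Lfun1_integrable; exact: Lfun2_mul_Lfun1.
rewrite ZZ' (Lfun1_EFin (Lfun21 tau2)) (Lfun1_EFin (Lfun21 tau'2)).
rewrite (Lfun1_EFin (Lfun2_mul_Lfun1 tau2 tau'2)).
move: (fine _) (fine _) (fine _) => x y z.
transitivity ((v * z + m ^+ 2 * y - m * z * (m * x))%:E); first by [].
by transitivity ((v * z + m ^+ 2 * (y - z * x))%:E); [congr (_%:E); ring|].
Qed.

End subordination.

(** * Moments of the Poisson process *)

Section nat_valued.
Context {R : realType} {d : measure_display} {T : measurableType d}.
Variable P : probability T R.

Lemma nneseries_trunc (u : nat -> \bar R) K :
  (forall n, (K <= n)%N -> u n = 0%E) ->
  (\sum_(n <oo) u n = \sum_(0 <= n < K) u n)%E.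
Proof.
move=> u0; apply: lim_near_cst => //; exists K => //= n /= Kn.
rewrite (big_cat_nat (n := K))//= [X in (_ + X)%E](_ : _ = 0%E) ?adde0//.
by rewrite big_nat_cond big1// => i /andP[/andP[/u0]].
Qed.

Lemma measurable_fun_nat d' (U : measurableType d') (N : U -> nat) :
  (forall n, measurable (N @^-1` [set n])) -> measurable_fun setT N.
Proof.
move=> mN _ B _; rewrite setTI.
rewrite (_ : _ @^-1` _ = \bigcup_(n in B) (N @^-1` [set n])).
  by apply: bigcup_measurable => n _.
by apply/seteqP; split=> [w Bw|w [n Bn /= ->]//]; exists (N w).
Qed.

Lemma ge0_integral_nat (N : T -> nat) (g : nat -> R) :
  measurable_fun setT N -> (forall n, 0 <= g n) ->
  (\int[P]_w (g (N w))%:E = \sum_(n <oo) (g n)%:E * P (N @^-1` [set n]))%E.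
Proof.
move=> mN g0.
have mNn n : measurable (N @^-1` [set n]).
  by rewrite -[X in measurable X]setTI; exact: mN.
transitivity (\int[P]_w \sum_(n <oo) ((g n)%:E * (\1_(N @^-1` [set n]) w)%:E))%E.
  apply: eq_integral => w _; rewrite (nneseries_trunc (K := (N w).+1)).
    rewrite big_nat_recr//= [X in (X + _)%E]big_nat_cond big1 ?add0e.
      by rewrite indicE mem_set// mule1.
    move=> n /andP[/andP[_ nN] _]; rewrite indicE memNset ?mule0//= => Nn.
    by rewrite Nn ltnn in nN.
  move=> n Nn; rewrite indicE memNset ?mule0//= => Nwn.
  by rewrite Nwn ltnn in Nn.
rewrite integral_nneseries//; last 2 first.
- move=> n; apply: measurable_funeM; apply/measurable_EFinP.
  exact: measurable_indic.
- by move=> n w _; rewrite mule_ge0// lee_fin.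
apply: eq_eseriesr => n _.
rewrite ge0_integralZl//; last 2 first.
- by apply/measurable_EFinP; exact: measurable_indic.
- by rewrite lee_fin.
by rewrite integral_indic// setIT.
Qed.

End nat_valued.

Section poisson_moments.
Context {R : realType} {d : measure_display} {T : measurableType d}.
Variable P : probability T R.
Variables (mu : R) (N : T -> nat).
Hypotheses (mu0 : 0 < mu) (mN : measurable_fun setT N).
Hypothesis NP : forall n, P (N @^-1` [set n]) = (poisson_pmf mu n)%:E.

Let pmfS n : n.+1%:R * poisson_pmf mu n.+1 = mu * poisson_pmf mu n.
Proof.
rewrite /poisson_pmf mu0 factS natrM exprS invfM.
have n0 : (n.+1%:R : R) != 0 by rewrite pnatr_eq0.
have f0 : (n`!%:R : R) != 0 by rewrite pnatr_eq0 -lt0n fact_gt0.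
by field; rewrite f0 addrC natr1 n0.
Qed.

(* P (N = n + 1) (n + 1) = mu P (N = n), summed against [g]: both moments
   follow without evaluating an exponential series *)
Let sum_size_biased (g : nat -> R) : (forall n, 0 <= g n) ->
  (\int[P]_w ((N w)%:R * g (N w))%:E = mu%:E * \int[P]_w (g (N w).+1)%:E)%E.
Proof.
move=> g0.
have p0 := @poisson_pmf_ge0 R mu.
rewrite (ge0_integral_nat P (g := fun n => n%:R * g n))//; last first.
  by move=> n; exact: mulr_ge0.
rewrite (ge0_integral_nat P (g := fun n => g n.+1))//.
rewrite -nneseriesZl; last by move=> n _; rewrite NP -EFinM lee_fin mulr_ge0.
rewrite nneseries_recl//; last by move=> n _; rewrite NP -EFinM lee_fin !mulr_ge0.
rewrite mul0r mul0e add0e -(nneseries_addn 1%N); last first.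
  by move=> n; rewrite NP -EFinM lee_fin !mulr_ge0.
apply: eq_eseriesr => n _; rewrite addn1 !NP -!EFinM; congr (_%:E).
by rewrite mulrAC pmfS; ring.
Qed.

Let int1 : (\int[P]_w 1%:E = 1 :> \bar R)%E.
Proof. by have := expectation_cst P 1; rewrite unlock. Qed.

Lemma poisson_mean : (\int[P]_w ((N w)%:R)%:E = mu%:E)%E.
Proof.
have := sum_size_biased (g := fun=> 1) (fun=> ler01).
rewrite int1 mule1 => <-.
by apply: eq_integral => w _; rewrite mulr1.
Qed.

Lemma poisson_moment2 : (\int[P]_w ((N w)%:R ^+ 2)%:E = (mu ^+ 2 + mu)%:E)%E.
Proof.
transitivity (mu%:E * \int[P]_w ((N w)%:R + 1)%:E)%E.
  under [in RHS]eq_integral do rewrite natr1.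
  by rewrite -(sum_size_biased (g := fun n => n%:R)).
under eq_integral do rewrite EFinD.
rewrite ge0_integralD//; last first.
  apply/measurable_EFinP; apply: measurableT_comp => //.
rewrite poisson_mean int1.
by rewrite -EFinD -EFinM; congr (_%:E); ring.
Qed.

End poisson_moments.

Section independence.
Context {R : realType} {d : measure_display} {T : measurableType d}.
Variable P : probability T R.

Lemma mutually_independent2 {d' : measure_display} {U : measurableType d'}
    {I : choiceType} (X : I -> T -> U) (i j : I) :
  mutually_independent P X -> i != j -> independent_maps P (X i) (X j).
Proof.
move=> XP ij A B mA mB.
have := XP [fset i; j]%fset (fun k => if k == i then A else B).
have ji : (j == i) = false by rewrite eq_sym; exact/negbTE.
rewrite big_fsetU1 ?inE//= big_seq_fset1 eqxx ji => <-; last by move=> k _; case: ifP.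
congr (P _); apply/seteqP; split=> [w [Aw Bw] k /=|w wAB].
  by rewrite !inE => /orP[]/eqP->; rewrite ?eqxx ?ji.
by split; [have := wAB i|have := wAB j]; rewrite /= !inE eqxx ?orbT ?ji; exact.
Qed.

Lemma increment_independent_past (X : R -> T -> R) (a b : R) :
  (forall w, X 0 w = 0) -> independent_increments P X -> 0 <= a -> a <= b ->
  independent_maps P (X a) (fun w => X b w - X a w).
Proof.
move=> X0 Xi a0 ab A B mA mB.
(* the past and the increment are the first two increments along 0, a, b *)
pose t n := if n is n'.+1 then if n' is _.+1 then b else a else 0.
have th : {homo t : m n / (m <= n)%N >-> m <= n}.
  by case=> [|[|m]] [|[|n]]//= _; exact: le_trans ab.
have := mutually_independent2 (i := 0%N) (j := 1%N) (Xi t (lexx _) th) isT mA mB.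
rewrite /= (_ : (fun w => X a w - X 0 w) = X a)//.
by apply/funext => w; rewrite X0 subr0.
Qed.

Lemma independent_expectationM {f g : T -> R} :
  f \in Lfun P 2%:E -> g \in Lfun P 2%:E -> independent_maps P f g ->
  'E_P[f \* g]%E = ('E_P[f] * 'E_P[g])%E.
Proof.
move=> f2 g2 fg; have fg1 := Lfun2_mul_Lfun1 f2 g2.
rewrite unlock (integral_independent (Lfun_measurable f2) (Lfun_measurable g2) fg
  (h := fun z => (z.1 * z.2)%:E)); last 2 first.
- by apply/measurable_EFinP; apply: measurable_funM.
- exact/Lfun1_integrable.
have /Lfun1_integrable fi := Lfun21 f2; have /Lfun1_integrable gi := Lfun21 g2.
under eq_integral => w _.
  under eq_integral do rewrite EFinM.
  rewrite (integralZl measurableT gi).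
  rewrite muleC -[X in (X * _)%E]fineK ?integrable_fin_num//.
  over.
by rewrite (integralZl measurableT fi) fineK ?integrable_fin_num// muleC.
Qed.

Lemma independent_covariance0 {f g : T -> R} :
  f \in Lfun P 2%:E -> g \in Lfun P 2%:E -> independent_maps P f g ->
  covariance P f g = 0%E.
Proof.
move=> f2 g2 fg; rewrite Lfun2_covE// independent_expectationM// subee//.
by rewrite fin_numM// expectation_fin_num// Lfun21.
Qed.

(** The mean and covariance functions of any square integrable process with
    stationary independent increments started at 0 *)
Definition levy_moments (S : R -> T -> R) (m v : R) : Prop :=
  [/\ forall t, 0 <= t -> S t \in Lfun P 2%:E,
      forall t, 0 <= t -> 'E_P[S t]%E = (m * t)%:E &
      forall s t, 0 <= s -> s <= t -> covariance P (S s) (S t) = (v * s)%:E].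

Lemma levy_moment2 (S : R -> T -> R) (m v s t : R) :
  levy_moments S m v -> 0 <= s -> s <= t ->
  'E_P[S s \* S t]%E = (v * s + m ^+ 2 * (s * t))%:E.
Proof.
move=> [S2 Sm Sv] s0 st; have t0 := le_trans s0 st.
rewrite (expectationM_covariance (S2 _ s0) (S2 _ t0) (Sm _ s0) (Sm _ t0) (Sv _ _ s0 st)).
by congr (_%:E); ring.
Qed.

Lemma poisson_process_measurable lambda N (t : R) :
  poisson_process P lambda N -> 0 <= t -> measurable_fun setT (N t).
Proof.
move=> [sN _] t0; apply: measurable_fun_nat => n.
have := subordinator_measurable sN t0 measurableT (measurable_set1 n%:R).
rewrite setTI; congr (measurable _); apply/seteqP; split=> w /=.
  by move/eqP; rewrite eqr_nat => /eqP.
by move->.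
Qed.

Lemma poisson_levy_moments lambda N : 0 < lambda ->
  poisson_process P lambda N ->
  levy_moments (fun t w => (N t w)%:R) lambda lambda.
Proof.
move=> l0 NP; have [sN pmfN] := NP.
have mN t : 0 <= t -> measurable_fun setT (N t).
  exact: poisson_process_measurable NP.
have N0 w : (N 0 w)%:R = 0 :> R by exact: subordinator0 sN w.
have mean t : 0 <= t -> 'E_P[fun w => (N t w)%:R]%E = (lambda * t)%:E.
  rewrite le_eqVlt => /predU1P[<-|t0].
    rewrite mulr0 (_ : (fun w => _) = cst 0) ?expectation_cst//.
    by apply/funext => w; rewrite N0.
  rewrite unlock (poisson_mean (mulr_gt0 l0 t0) (mN _ (ltW t0)))//.
  by move=> n; rewrite pmfN.
have moment2 t : 0 <= t -> (\int[P]_w ((N t w)%:R ^+ 2)%:E)%E =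
    ((lambda * t) ^+ 2 + lambda * t)%:E.
  rewrite le_eqVlt => /predU1P[<-|t0].
    rewrite mulr0 expr0n/= addr0 -[RHS](expectation_cst P) unlock.
    by apply: eq_integral => w _; rewrite N0 expr0n.
  rewrite (poisson_moment2 (mulr_gt0 l0 t0) (mN _ (ltW t0)))//.
  by move=> n; rewrite pmfN.
have N2 t : 0 <= t -> (fun w => (N t w)%:R) \in Lfun P 2%:E.
  move=> t0; apply: Lfun2_sqr_integrable; last by rewrite moment2// ltry.
  exact: (subordinator_measurable sN t0).
split=> // s t s0 st; have t0 := le_trans s0 st.
have -> : (fun w => (N t w)%:R : R) =
    (fun w => (N s w)%:R) \+ (fun w => (N t w)%:R - (N s w)%:R).
  by apply/funext => w /=; rewrite addrC subrK.
have inc2 : (fun w => (N t w)%:R - (N s w)%:R) \in Lfun P 2%:E.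
  exact: Lfun2B (N2 t t0) (N2 s s0).
rewrite covarianceDr ?N2// (@independent_covariance0 _ _ (N2 s s0) inc2).
  rewrite adde0 Lfun2_covE ?N2// mean// unlock.
  under eq_integral do rewrite /= -expr2.
  by rewrite moment2// -EFinM -EFinB; congr (_%:E); ring.
exact: (increment_independent_past (X := fun t w => (N t w)%:R) N0
  (subordinator_independent_increments sN)).
Qed.

End independence.

(** * Compound sums: the processes of order k *)

Section generated_sigma_algebra.
Context {R : realType} {d d' : measure_display} {T : measurableType d}
  {U : measurableType d'} {I : Type}.
Variables (D : set I) (X : I -> T -> U).

(** The probability space with the coarser sigma-algebra generated by the
    [X i], [i] in [D]: independence of two processes becomes independence of the
    identity maps into two such spaces. *)
Definition sigma_space : Type :=
  g_sigma_algebraType (\bigcup_(i in D) preimage_set_system setT (X i) measurable).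

HB.instance Definition _ := Measurable.on sigma_space.

Lemma measurable_sigma_space i : D i ->
  measurable_fun [set: sigma_space] (X i : sigma_space -> U).
Proof.
move=> Di _ B mB; rewrite setTI; apply: sub_sigma_algebra.
by exists i => //; exists B; rewrite ?setTI.
Qed.

Lemma sigma_of_measurable : (forall i, D i -> measurable_fun setT (X i)) ->
  forall A : set T, sigma_of D X A -> measurable A.
Proof.
move=> mX A; apply: smallest_sub; first exact: sigma_algebra_measurable.
by move=> B [i Di [C mC <-]]; exact: mX.
Qed.

Lemma measurable_to_sigma_space : (forall i, D i -> measurable_fun setT (X i)) ->
  measurable_fun [set: T] (id : T -> sigma_space).
Proof. by move=> mX _ B mB; rewrite setTI; exact: sigma_of_measurable. Qed.

End generated_sigma_algebra.

Lemma measurable_fun_natprod {d d'} {U : measurableType d} {V : measurableType d'}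
    (f : nat -> U -> V) : (forall n, measurable_fun setT (f n)) ->
  measurable_fun [set: nat * U] (fun z => f z.1 z.2).
Proof.
move=> mf _ B mB; rewrite setTI.
rewrite (_ : _ @^-1` _ = \bigcup_n ([set n] `*` (f n @^-1` B))).
  apply: bigcup_measurable => n _; apply: measurableX => //.
  by rewrite -[X in measurable X]setTI; exact: mf.
apply/seteqP; split=> [[n u] Bu|[n u] [k _ [/= -> Bu]]//].
by exists n.
Qed.

Arguments measurable_sigma_space {d d' T U I D} X {i}.

Section discrete_uniform.
Context {R : realType} {d : measure_display} {T : measurableType d}.
Variables (P : probability T R) (k : nat) (X : T -> nat).
Hypotheses (k1 : (1 <= k)%N) (mX : measurable_fun setT X).
Hypothesis XP : forall j, (1 <= j <= k)%N -> P (X @^-1` [set j]) = (k%:R^-1)%:E.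

(* the k masses 1/k already add up to 1 *)
Let XP0 n : ~~ (1 <= n <= k)%N -> P (X @^-1` [set n]) = 0%E.
Proof.
have := ge0_integral_nat P mX (g := fun=> 1) (fun=> ler01).
rewrite [LHS](_ : _ = 1%E); last by have := expectation_cst P 1; rewrite unlock.
under eq_eseriesr do rewrite mul1e.
rewrite (nneseries_split 0 k.+1)// add0n big_nat_recl//.
rewrite big_nat.
under eq_bigr => i ik do rewrite XP//.
rewrite -big_nat sumEFin sumr_const_nat subn0.
have -> : k%:R^-1 *+ k = 1 :> R.
  by rewrite -(mulr_natr _^-1) mulVf// pnatr_eq0 -lt0n.
rewrite addeAC => /(congr1 (fun x => x - 1)%E).
rewrite addeK// subee// => /esym/eqP.
rewrite padde_eq0 ?nneseries_ge0// => /andP[/eqP p0 /eqP pk].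
rewrite negb_and -ltnNge ltnS leqn0 -ltnNge => /orP[/eqP->//|kn].
apply/eqP; rewrite eq_le measure_ge0 andbT -[X in (_ <= X)%E]pk.
rewrite (nneseries_split k.+1 (n - k))// addSn subnKC 1?ltnW//.
rewrite big_nat_recr//=.
rewrite -[X in (X <= _)%E]adde0 leeD ?nneseries_ge0//.
rewrite -[X in (X <= _)%E]add0e leeD//.
by apply: sume_ge0.
Qed.

Lemma discrete_uniform_integral (g : nat -> R) : (forall n, 0 <= g n) ->
  (\int[P]_w (g (X w))%:E)%E = (\sum_(1 <= j < k.+1) g j / k%:R)%:E.
Proof.
move=> g0; rewrite ge0_integral_nat// (nneseries_trunc (K := k.+1)); last first.
  by move=> n kn; rewrite XP0 ?mule0// negb_and -(ltnNge k) kn orbT.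
rewrite big_nat_recl// XP0// mule0 add0e big_add1/= -sumEFin.
by rewrite !big_nat; apply: eq_bigr => i ik; rewrite XP.
Qed.

End discrete_uniform.

Section walk.
Context {R : realType} {d : measure_display} {T : measurableType d}.
Variables (P : probability T R) (X : nat -> T -> R) (mu v : R).
Hypothesis X2 : forall i, X i \in Lfun P 2%:E.
Hypothesis Xmean : forall i, 'E_P[X i]%E = mu%:E.
Hypothesis Xcov : forall i j, covariance P (X i) (X j) = (v *+ (i == j))%:E.

Definition walk n w := \sum_(0 <= i < n) X i w.

Let walk0 : walk 0 = cst 0.
Proof. by apply/funext => w; rewrite /walk big_geq. Qed.

Let walkS n : walk n.+1 = walk n \+ X n.
Proof. by apply/funext => w; rewrite /walk big_nat_recr. Qed.

Lemma walk_Lfun2 n : walk n \in Lfun P 2%:E.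
Proof.
elim: n => [|n IH]; first by rewrite walk0 Lfun_cst.
by rewrite walkS; apply: rpredD => //; rewrite lee1n.
Qed.

Lemma walk_mean n : 'E_P[walk n]%E = (mu * n%:R)%:E.
Proof.
elim: n => [|n IH]; first by rewrite walk0 expectation_cst mulr0.
rewrite walkS expectationD ?Lfun21 ?walk_Lfun2// IH Xmean -EFinD.
by congr (_%:E); rewrite -natr1; ring.
Qed.

Let walk_covX a j : covariance P (walk a) (X j) = (v *+ (j < a)%N)%:E.
Proof.
elim: a => [|a IH]; first by rewrite walk0 covariance_cst_l.
rewrite walkS covarianceDl ?walk_Lfun2// IH Xcov -EFinD ltnS.
by rewrite (eq_sym a); case: ltngtP => _ /=; rewrite ?addr0 ?add0r.
Qed.

Lemma walk_covariance a b : (a <= b)%N ->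
  covariance P (walk a) (walk b) = (v * a%:R)%:E.
Proof.
suff H : covariance P (walk a) (walk b) = (v * (minn a b)%:R)%:E.
  by move=> ab; rewrite H (minn_idPl ab).
elim: b => [|b IH]; first by rewrite minn0 walk0 covariance_cst_r mulr0.
rewrite walkS covarianceDr ?walk_Lfun2// IH walk_covX -EFinD; congr (_%:E).
case: (ltnP b a) => ab; first by rewrite (minn_idPr ab) -natr1 mulrDr mulr1.
have ab1 : (a <= b.+1)%N by exact: leqW.
by rewrite (minn_idPl ab1) addr0.
Qed.

Lemma walk_moment2 a b : (a <= b)%N ->
  'E_P[walk a \* walk b]%E = (v * a%:R + mu ^+ 2 * (a%:R * b%:R))%:E.
Proof.
move=> ab; have W2 := walk_Lfun2.
rewrite (expectationM_covariance (W2 a) (W2 b) (walk_mean a) (walk_mean b) (walk_covariance ab)).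
by congr (_%:E); ring.
Qed.

End walk.

Section compound_poisson.
Context {R : realType} {d : measure_display} {T : measurableType d}.
Variable P : probability T R.

Lemma measurable_natr : measurable_fun [set: nat] (fun n => n%:R : R).
Proof. by []. Qed.

(** The [p]-th moment of the uniform law on 1, ..., k *)
Definition step_moment k p : R := \sum_(1 <= j < k.+1) j%:R ^+ p / k%:R.

Lemma step_moment2_gt0 k : (1 <= k)%N -> 0 < step_moment k 2.
Proof.
move=> k1; rewrite /step_moment big_ltn// expr1n.
rewrite ltr_pwDl ?divr_gt0 ?ltr0n//.
by apply: sumr_ge0 => i _; rewrite divr_ge0// exprn_ge0.
Qed.

(** With steps of mean [mu] and second moment [q], the compound sum at
    Poisson times of rate [L] has variance rate (q - mu^2) L + mu^2 L = q L. *)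
Lemma PPoK_levy_moments k lambda M : (1 <= k)%N -> 0 < lambda ->
  PPoK P k lambda M ->
  levy_moments P (fun t w => (M t w)%:R)
    (step_moment k 1 * (k%:R * lambda)) (step_moment k 2 * (k%:R * lambda)).
Proof.
move=> k1 l0 [N [X [NP [mX XI] XP NX MNX]]].
have L0 : 0 < k%:R * lambda by rewrite mulr_gt0// ltr0n.
have [N2 Nm Nv] := poisson_levy_moments L0 NP.
set L := k%:R * lambda in L0 N2 Nm Nv *.
have X2 i : (fun w => (X i w)%:R : R) \in Lfun P 2%:E.
  apply: Lfun2_sqr_integrable; first exact: (measurableT_comp measurable_natr).
  rewrite (discrete_uniform_integral k1 (mX i) (XP i) (g := fun n => n%:R ^+ 2)).
    by rewrite ltry.
  by move=> n; rewrite exprn_ge0.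
have Xm i : 'E_P[fun w => (X i w)%:R]%E = (step_moment k 1)%:E.
  rewrite unlock (discrete_uniform_integral k1 (mX i) (XP i) (g := fun n => n%:R))//.
have Xc i j : covariance P (fun w => (X i w)%:R) (fun w => (X j w)%:R) =
    ((step_moment k 2 - step_moment k 1 ^+ 2) *+ (i == j))%:E.
  have [<-|ij] := eqVneq i j.
    rewrite Lfun2_covE// Xm unlock.
    under eq_integral do rewrite /= -expr2.
    rewrite (discrete_uniform_integral k1 (mX i) (XP i) (g := fun n => n%:R ^+ 2)).
      by rewrite -EFinM -EFinB expr2.
    by move=> n; rewrite exprn_ge0.
  rewrite independent_covariance0// => A B mA mB.
  exact: (mutually_independent2 XI ij (A := (fun n => n%:R : R) @^-1` A)
    (B := (fun n => n%:R : R) @^-1` B)).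
pose W n w := walk (fun i w => (X i w)%:R : R) n w.
have MW t : 0 <= t -> (fun w => (M t w)%:R) = fun w => W (N t w) w.
  by move=> t0; apply/funext => w; rewrite MNX// natr_sum /W /walk big_mkord.
pose U := sigma_space setT X.
have mU : measurable_fun [set: T] (id : T -> U) by exact: measurable_to_sigma_space.
have mW : measurable_fun [set: nat * U] (fun z => W z.1 z.2).
  apply: measurable_fun_natprod => n; apply: measurable_sum => i.
  apply: (measurableT_comp measurable_natr); exact: measurable_sigma_space.
have mN t : 0 <= t -> measurable_fun setT (N t).
  exact: poisson_process_measurable NP.
have tauX s t : 0 <= s -> 0 <= t ->
    independent_maps P (fun w => (N s w, N t w)) (id : T -> U).
  move=> s0 t0 A B mA mB; apply: NX => //.
  have := @measurable_fun_pair _ _ _ (sigma_space [set t : R | 0 <= t] N) _ _ _ _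
    (measurable_sigma_space (D := [set t : R | 0 <= t]) (i := s) N s0)
    (measurable_sigma_space (D := [set t : R | 0 <= t]) (i := t) N t0).
  by move=> /(_ measurableT A mA); rewrite setTI.
have Nle s t w : 0 <= s -> s <= t -> (N s w)%:R <= (N t w)%:R :> R.
  by case: NP => sN _; exact: (subordinator_nondecreasing sN).
have Wm a : True -> 'E_P[W a \o id]%E = (step_moment k 1 * a%:R)%:E.
  by move=> _; exact: walk_mean.
have W2 a b : True -> True -> a%:R <= b%:R :> R -> 'E_P[(W a \o id) \* (W b \o id)]%E =
    ((step_moment k 2 - step_moment k 1 ^+ 2) * a%:R +
    (step_moment k 1) ^+ 2 * (a%:R * b%:R))%:E.
  by rewrite ler_nat => _ _ ab; exact: walk_moment2.
split=> [t t0|t t0|s t s0 st].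
- rewrite MW//; have [] := subordination_Lfun2 mU mW W2 (mN t t0) (mN t t0)
    (fun=> I) (fun=> I) (N2 t t0) (N2 t t0) (tauX t t t0 t0).
  by [].
- rewrite MW// (subordination_mean mU mW Wm W2 (mN t t0) (mN t t0)
    (fun=> I) (fun=> I) (N2 t t0) (N2 t t0) (tauX t t t0 t0)).
  by rewrite Nm// -EFinM mulrA.
- have t0 := le_trans s0 st.
  rewrite !MW// (subordination_covariance mU measurable_natr mW Wm W2
    (mN s s0) (mN t t0) (fun=> I) (fun=> I)
    (aeW P (fun w => Nle s t w s0 st)) (N2 s s0) (N2 t t0) (tauX s t s0 t0)).
  rewrite Nm// Nv// -!EFinM -EFinD; congr (_%:E); ring.
Qed.

Lemma SPoK_levy_moments k lambda1 lambda2 S : (1 <= k)%N ->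
  0 < lambda1 -> 0 < lambda2 -> SPoK P k lambda1 lambda2 S ->
  levy_moments P S (step_moment k 1 * (k%:R * (lambda1 - lambda2)))
    (step_moment k 2 * (k%:R * (lambda1 + lambda2))).
Proof.
move=> k1 l1 l2 [M1 [M2 [PM1 PM2 M12 SM]]].
have [M12L M1m M1c] := PPoK_levy_moments k1 l1 PM1.
have [M22L M2m M2c] := PPoK_levy_moments k1 l2 PM2.
have SE t : 0 <= t -> S t = (fun w => (M1 t w)%:R) \- (fun w => (M2 t w)%:R).
  by move=> t0; apply/funext => w; rewrite SM.
have c0 s t : 0 <= s -> 0 <= t ->
    covariance P (fun w => (M1 s w)%:R) (fun w => (M2 t w)%:R) = 0%E.
  move=> s0 t0; apply: independent_covariance0; [exact: M12L|exact: M22L|].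
  move=> A B mA mB; apply: (M12 (M1 s @^-1` ((fun n => n%:R : R) @^-1` A))
    (M2 t @^-1` ((fun n => n%:R : R) @^-1` B))).
  + by rewrite -[X in sigma_of _ _ X]setTI; apply: measurable_sigma_space.
  + by rewrite -[X in sigma_of _ _ X]setTI; apply: measurable_sigma_space.
split=> [t t0|t t0|s t s0 st].
- by rewrite SE//; apply: Lfun2B; [exact: M12L|exact: M22L].
- rewrite SE// expectationB ?Lfun21 ?M12L ?M22L// M1m// M2m// -EFinB.
  by congr (_%:E); ring.
- have t0 := le_trans s0 st.
  rewrite !SE// covarianceBl ?M12L ?M22L//; last first.
    by apply: Lfun2B; [exact: M12L|exact: M22L].
  rewrite !covarianceBr ?M12L ?M22L// (c0 s t s0 t0).
  rewrite [X in (_ - (X - _))%E]covarianceC (c0 t s t0 s0).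
  by rewrite M1c// M2c// sube0 sub0e oppeK -EFinD; congr (_%:E); ring.
Qed.

End compound_poisson.

(** * Right-continuous processes at random times *)

Section right_continuity.
Context {R : realType}.

(** [grid n x / n.+1] is the first point of mesh [1 / n.+1] strictly to the
    right of [max x 0]: right limits see only such points. *)
Definition grid (n : nat) (x : R) : nat :=
  (Num.truncn (n.+1%:R * Num.max x 0)).+1.

Let grid_arg_ge0 n x : 0 <= n.+1%:R * Num.max x 0 :> R.
Proof. by rewrite mulr_ge0// le_max lexx orbT. Qed.

Lemma grid_gt n x : Num.max x 0 < (grid n x)%:R / n.+1%:R.
Proof.
rewrite ltr_pdivlMr ?ltr0n// mulrC /grid.
by have /andP[] := truncn_itv (grid_arg_ge0 n x).
Qed.

Lemma grid_le n x : (grid n x)%:R / n.+1%:R <= Num.max x 0 + n.+1%:R^-1.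
Proof.
rewrite ler_pdivrMr ?ltr0n// mulrDl mulVf ?pnatr_eq0//.
rewrite /grid -natr1 lerD2r [leRHS]mulrC.
by have /andP[] := truncn_itv (grid_arg_ge0 n x).
Qed.

Lemma measurable_grid n : measurable_fun setT (grid n).
Proof.
apply: measurable_fun_nat => -[|k].
  by rewrite (_ : _ @^-1` _ = set0)//; apply/seteqP; split.
pose f x : R := n.+1%:R * Num.max x 0.
have mf : measurable_fun setT f.
  by apply: measurable_funM => //; exact: measurable_maxr.
rewrite (_ : _ @^-1` _ = f @^-1` `[k%:R, k.+1%:R[).
  by rewrite -[X in measurable X]setTI; exact: mf.
have f0 x : 0 <= f x := grid_arg_ge0 n x.
apply/seteqP; split=> x; rewrite /= in_itv/=.
  by move=> [<-]; exact: truncn_itv.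
by move=> kx; congr (_.+1); apply/eqP; rewrite truncn_eq.
Qed.

Lemma cvg_grid x : (grid n x)%:R / n.+1%:R @[n --> \oo] --> Num.max x 0.
Proof.
apply: (@squeeze_cvgr _ _ _ _ (fun=> Num.max x 0)
  (fun n => Num.max x 0 + n.+1%:R^-1)).
- by apply: nearW => n; rewrite ltW ?grid_gt// grid_le.
- exact: cvg_cst.
- rewrite -[X in _ --> X]addr0; apply: cvgD; first exact: cvg_cst.
  exact: cvg_harmonic.
Qed.

(** Joint measurability: [S] at time [x] is the limit of [S] at the grid points
    to the right of [x], and along a grid only countably many times occur.
    Times are clipped at 0, as nothing is known of [S] at negative ones. *)
Lemma measurable_right_continuous {d} {U : measurableType d} (S : R -> U -> R) :
  (forall t, 0 <= t -> measurable_fun setT (S t)) ->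
  (forall u t, 0 <= t -> S r u @[r --> t^'+] --> S t u) ->
  measurable_fun [set: R * U] (fun z => S (Num.max z.1 0) z.2).
Proof.
move=> mS rcS.
pose h n (z : R * U) := S ((grid n z.1)%:R / n.+1%:R) z.2.
apply: (@measurable_fun_cvg _ _ _ _ h) => [n|[x u] _]; last first.
  have := rcS u (Num.max x 0); rewrite le_max lexx orbT => /(_ isT).
  move=> /cvg_at_rightP; apply; split; last exact: cvg_grid.
  by move=> n; exact: grid_gt.
have mk k : measurable_fun [set: U] (S (k%:R / n.+1%:R)) by apply: mS.
have := measurable_fun_natprod mk => mSn.
apply: (measurableT_comp mSn (measurable_fun_pair
  (measurableT_comp (measurable_grid n) measurable_fst) measurable_snd)).
Qed.

Context {d : measure_display} {T : measurableType d}.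
Variable P : probability T R.

(** A right-continuous integer-valued path is locally constant to the right,
    and the compound sum changes only when the Poisson process does. *)
Lemma PPoK_right_continuous k lambda M w (t : R) : PPoK P k lambda M -> 0 <= t ->
  \forall u \near t^'+, M u w = M t w.
Proof.
move=> [N [X [[sN _] _ _ _ MNX]]] t0.
have /cvgrPdist_lt/(_ 1 ltr01) := subordinator_right_continuous sN t0 (w := w).
move=> N1; near=> u.
have tu : t < u by near: u; exact: nbhs_right_gt.
have u0 : 0 <= u by rewrite (le_trans t0)// ltW.
rewrite !MNX//; suff -> : N u w = N t w by [].
have tuN : (N t w <= N u w)%N.
  by have := subordinator_nondecreasing sN w t0 (ltW tu); rewrite ler_nat.
apply/eqP; rewrite eqn_leq tuN andbT -ltnS -(ltr_nat R) -natr1 -ltrBlDl.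
have : `|(N t w)%:R - (N u w)%:R| < 1 :> R by near: u.
by rewrite distrC ger0_norm// subr_ge0 ler_nat.
Unshelve. all: by end_near. Qed.

Lemma SPoK_right_continuous k lambda1 lambda2 S w (t : R) :
  SPoK P k lambda1 lambda2 S -> 0 <= t -> S u w @[u --> t^'+] --> S t w.
Proof.
move=> [M1 [M2 [PM1 PM2 _ SM]]] t0.
apply: cvg_near_cst; near=> u.
have tu : t < u by near: u; exact: nbhs_right_gt.
have u0 : 0 <= u by rewrite (le_trans t0)// ltW.
rewrite !SM//; congr (_%:R - _%:R); near: u.
  exact: PPoK_right_continuous PM1 t0.
exact: PPoK_right_continuous PM2 t0.
Unshelve. all: by end_near. Qed.

End right_continuity.

(** * First passage times of a subordinator *)

Section first_passage.
Context {R : realType} {d : measure_display} {T : measurableType d}.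
Variables (P : probability T R) (D : R -> T -> R).
Hypothesis subD : subordinator P D.

Let Y := first_passage D.

Let mD r : 0 <= r -> measurable_fun setT (D r).
Proof. exact: subordinator_measurable subD r. Qed.

Lemma measurable_le_level r t : 0 <= r -> measurable [set w | D r w <= t].
Proof.
by move=> r0; apply: measurable_sublevel; exact: mD.
Qed.

Lemma measurable_gt_level r t : 0 <= r -> measurable [set w | t < D r w].
Proof.
move=> r0; rewrite [X in measurable X](_ : _ = ~` [set w | D r w <= t]).
  exact/measurableC/measurable_le_level.
by apply/seteqP; split=> w /=; rewrite ltNge => /negP.
Qed.

Lemma first_passage_ge0 t w : 0 <= Y t w.
Proof.
rewrite /Y /first_passage; have [->|/set0P S0] := eqVneq [set r | 0 <= r /\ t < D r w] set0.
  by rewrite inf0.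
by apply: lb_le_inf => // r [].
Qed.

Lemma first_passage_le r t w : 0 <= r -> t < D r w -> Y t w <= r.
Proof.
move=> r0 tD; apply: ge_inf; last by split.
by exists 0 => x [].
Qed.

Lemma le_level r t w : 0 <= r -> r < Y t w -> D r w <= t.
Proof.
move=> r0; apply: contraTle => tD; rewrite -leNgt; exact: first_passage_le.
Qed.

(** The outcomes for which the infimum defining the passage above [t] is that
    of a nonempty set; almost all of them are such. *)
Definition crosses t w := exists n : nat, t < D n%:R w.

Lemma le_first_passage r t w : 0 <= r -> crosses t w -> D r w <= t -> r <= Y t w.
Proof.
move=> r0 [n tn] Drt; apply: lb_le_inf; first by exists n%:R; split.
move=> x [x0 tDx]; rewrite leNgt; apply/negP => xr.
have := subordinator_nondecreasing subD w x0 (ltW xr).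
by rewrite leNgt (le_lt_trans Drt tDx).
Qed.

(** Right-continuity keeps the path below [t'] for a while after [r]. *)
Lemma lt_first_passage r t t' w : 0 <= r -> t < t' -> crosses t' w ->
  D r w <= t -> r < Y t' w.
Proof.
move=> r0 tt' ct' Drt.
have /cvgrPdist_lt/(_ (t' - t)) := subordinator_right_continuous subD r0 (w := w).
rewrite subr_gt0 => /(_ tt') near_r.
have : \forall u \near r^'+, r < u /\ D u w <= t'.
  near=> u; split; first by near: u; exact: nbhs_right_gt.
  have : `|D r w - D u w| < t' - t by near: u.
  rewrite ltr_distlC => /andP[_]; lra.
move=> /filter_ex[u [ru Du]]; rewrite (lt_le_trans ru)//.
by apply: le_first_passage => //; rewrite (le_trans r0)// ltW.
Unshelve. all: by end_near. Qed.

Lemma first_passage_mono s t w : s <= t -> crosses t w -> Y s w <= Y t w.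
Proof.
move=> st [n tn]; apply: lb_le_inf; first by exists n%:R; split.
by move=> x [x0 tDx]; apply: first_passage_le => //; exact: le_lt_trans tDx.
Qed.

(** The passage time is smaller than [r > 0] if the path exceeds [t] a little
    before [r].  The only other outcomes are those whose path never exceeds [t],
    where the infimum of the empty set is 0; the intersection below collects
    them. *)
Lemma measurable_first_passage t : measurable_fun setT (Y t).
Proof.
apply: (measurability _ (RGenInftyO.measurableE R)) => // _ [_ [r ->] <-].
rewrite setTI.
have [r0|r0] := leP r 0.
  rewrite (_ : _ @^-1` _ = set0)//; apply/seteqP; split=> w //=.
  by rewrite in_itv/= ltNge (le_trans r0)// first_passage_ge0.
pose q n := Num.max (r - n.+1%:R^-1) 0.
have q0 n : 0 <= q n by rewrite le_max lexx orbT.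
rewrite (_ : _ @^-1` _ = (\bigcup_n [set w | t < D (q n) w]) `|`
    \bigcap_n [set w | D n%:R w <= t]).
  apply: measurableU.
    by apply: bigcup_measurable => n _; exact: measurable_gt_level.
  by apply: bigcap_measurable => // n _; exact: measurable_le_level.
apply/seteqP; split=> w /=; rewrite in_itv/=.
  have [ct Yr|nct _] := pselect (crosses t w); last first.
    by right=> n _ /=; rewrite leNgt; apply/negP => tn; apply: nct; exists n.
  left; have [n tn] := ct.
  have [x [x0 tx] xr] : exists2 x, 0 <= x /\ t < D x w & x < r.
    by apply: (inf_lt _ Yr); exists n%:R; split.
  have := ltr_add_invr xr => -[k kr]; exists k => //=.
  apply: lt_le_trans tx _; apply: (subordinator_nondecreasing subD) => //.
  by rewrite le_max lerBrDr ltW.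
move=> [[n _ /= tq]|Dt].
  apply: le_lt_trans (first_passage_le (q0 n) tq) _.
  by rewrite gt_max r0 andbT ltrBlDr ltrDl invr_gt0 ltr0n.
rewrite /Y /first_passage (_ : mkset _ = set0) ?inf0//.
apply/seteqP; split=> x //= [x0]; rewrite ltNge => /negP; apply.
have [n xn] : exists n : nat, x <= n%:R.
  by exists (Num.truncn x).+1; have /andP[_ /ltW] := truncn_itv x0.
exact: le_trans (subordinator_nondecreasing subD w x0 xn) (Dt n I).
Qed.

End first_passage.

(** * Stable subordinators: tails of the passage times *)

Section stable_levels.
Context {R : realType} {d : measure_display} {T : measurableType d}.
Variables (P : probability T R) (D : R -> T -> R) (alpha : R).
Hypothesis stD : stable_subordinator P alpha D.

Let subD : subordinator P D. Proof. by case: stD. Qed.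

Let mD r : 0 <= r -> measurable_fun setT (D r).
Proof. exact: subordinator_measurable subD r. Qed.

Let D_ge0 r w : 0 <= r -> 0 <= D r w.
Proof.
move=> r0; rewrite -(subordinator0 subD w).
exact: subordinator_nondecreasing subD w 0 r (lexx 0) r0.
Qed.

Let laplace1 r : 0 <= r ->
  (\int[P]_w (expR (- D r w))%:E = (expR (- r))%:E)%E.
Proof.
move=> r0; have [_ /(_ 1 r ltr01 r0)] := stD.
rewrite unlock powR1 mulr1 => <-.
by apply: eq_integral => w _; rewrite mulN1r.
Qed.

Let mexpD r : 0 <= r -> measurable_fun setT (fun w => (expR (- D r w))%:E).
Proof.
move=> r0; apply/measurable_EFinP; apply: measurableT_comp => //.
by apply: measurable_funN; exact: mD.
Qed.

Let mlevel r t : 0 <= r ->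
  measurable_fun setT (fun w => (\1_[set w | D r w <= t] w : R)%:E).
Proof.
move=> r0; apply/measurable_EFinP/measurable_indic.
exact: measurable_le_level subD _ _ r0.
Qed.

Let int_level r t : 0 <= r ->
  (\int[P]_w (\1_[set w | D r w <= t] w : R)%:E)%E = P [set w | D r w <= t].
Proof.
move=> r0; rewrite integral_indic ?setIT//.
exact: measurable_le_level subD _ _ r0.
Qed.

(** Markov's inequality for [e^(- D r)], whose mean is [e^(- r)] *)
Lemma level_upper r t : 0 <= r ->
  (P [set w | (D r w <= t)%R] <= (expR (t - r))%:E)%E.
Proof.
move=> r0; rewrite expRD EFinM -laplace1// -ge0_integralZl ?lee_fin ?expR_ge0//; last first.
  exact: mexpD.
rewrite -int_level//; apply: ge0_le_integral => //.
- exact: mlevel.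
- by apply: measurable_funeM; exact: mexpD.
move=> w _; rewrite -EFinM lee_fin indicE -expRD.
have [|] := leP (D r w) t => Dt.
  by rewrite mem_set//= -expR0 ler_expR subr_ge0.
rewrite memNset/=; last by apply/negP; rewrite -ltNge.
exact: expR_ge0.
Qed.

(** On the complement of the event [e^(- D r)] is at most [e^(- t)]. *)
Lemma level_lower r t : 0 <= r ->
  ((expR (- r))%:E <= P [set w | (D r w <= t)%R] + (expR (- t))%:E)%E.
Proof.
move=> r0; rewrite -laplace1// -int_level//.
have -> : (expR (- t))%:E = (\int[P]_w (expR (- t))%:E)%E.
  by have := expectation_cst P (expR (- t)); rewrite unlock => /esym.
rewrite -ge0_integralD//; last first.
  exact: mlevel.
apply: ge0_le_integral => //.
- exact: mexpD.
- by apply: emeasurable_funD => //; exact: mlevel.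
move=> w _; rewrite -EFinD lee_fin indicE.
have [|] := leP (D r w) t => Dt.
  rewrite mem_set//=; apply: (@le_trans _ _ 1); last by rewrite lerDl expR_ge0.
  by rewrite expR_le1 oppr_le0 D_ge0.
rewrite memNset/=; last by apply/negP; rewrite -ltNge.
by rewrite add0r ler_expR lerN2 ltW.
Qed.

Lemma ae_crosses t : {ae P, forall w, crosses D t w}.
Proof.
exists (\bigcap_n [set w | D n%:R w <= t]); split.
- by apply: bigcap_measurable => // n _; exact: measurable_le_level subD _ _ _.
- apply/eqP; rewrite eq_le measure_ge0 andbT; apply/lee_addgt0Pr => e e0.
  rewrite add0e.
  have [n nP] : exists n : nat, t - ln e <= n%:R.
    by exists (Num.truncn (t - ln e)).+1; apply/ltW/truncnS_gt.
  apply: le_trans (le_trans _ (level_upper t (ler0n R n))) _.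
    apply: le_measure; rewrite ?inE.
    + by apply: bigcap_measurable => // k _; exact: measurable_le_level subD _ _ _.
    + exact: measurable_le_level subD _ _ _.
    + by move=> w; exact.
  rewrite lee_fin -[leRHS]lnK ?ler_expR//; lra.
- move=> w /= nc n _ /=; rewrite leNgt; apply/negP => tn; apply: nc.
  by exists n.
Qed.

End stable_levels.

(** * Moments of the passage times as sums over a grid *)

Section grid_sums.
Context {R : realType} {d : measure_display} {T : measurableType d}.
Variables (P : probability T R) (D : R -> T -> R) (alpha : R).
Hypothesis stD : stable_subordinator P alpha D.

Let subD : subordinator P D. Proof. by case: stD. Qed.
Let Y := first_passage D.
Let mY t : measurable_fun setT (Y t) := measurable_first_passage subD t.

(** The number of the [n] for which this event occurs, times [delta],
    approximates the passage time above [t] up to [delta]. *)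
Definition level (delta t : R) (n : nat) : set T :=
  [set w | D (n%:R * delta) w <= t].

Lemma measurable_level delta t n : 0 < delta -> measurable (level delta t n).
Proof.
by move=> d0; apply: measurable_le_level subD _ _ _; rewrite mulr_ge0// ltW.
Qed.

(** [k.+1] is the smallest index of a grid point at which the path exceeds
    [t]. *)
Lemma level_index delta t w : 0 < delta -> 0 <= t -> crosses D t w ->
  exists k : nat, (forall n, (D (n%:R * delta) w <= t) = (n <= k)%N) /\
    k%:R * delta <= Y t w <= k.+1%:R * delta.
Proof.
move=> d0 t0 ct; have [m tm] := ct.
have nd0 n : 0 <= n%:R * delta by rewrite mulr_ge0// ltW.
have exn : exists n : nat, t < D (n%:R * delta) w.
  exists (Num.truncn (m%:R / delta)).+1; apply: lt_le_trans tm _.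
  apply: (subordinator_nondecreasing subD) => //.
  by rewrite -ler_pdivrMr//; apply/ltW/truncnS_gt.
case: (ex_minnP exn) => -[|k].
  by rewrite mul0r (subordinator0 subD) ltNge t0.
move=> tk kmin; exists k; split.
  move=> n; apply/idP/idP => [|nk].
    apply: contraTT; rewrite -ltnNge -ltNge => kn.
    apply: lt_le_trans tk _; apply: (subordinator_nondecreasing subD) => //.
    by rewrite ler_pM2r// ler_nat.
  rewrite leNgt; apply/negP => /kmin; by rewrite ltnNge nk.
apply/andP; split; last exact: first_passage_le.
apply: (le_first_passage subD) => //.
by rewrite leNgt; apply/negP => /kmin; rewrite ltnn.
Qed.

Lemma sum_levels (g : nat -> R) delta t w k :
  (forall n, (D (n%:R * delta) w <= t) = (n <= k)%N) ->
  (\sum_(n <oo) (g n)%:E * (\1_(level delta t n) w)%:E =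
   (\sum_(0 <= n < k.+1) g n)%:E)%E.
Proof.
move=> Dk; rewrite (nneseries_trunc (K := k.+1)); last first.
  move=> n kn; rewrite indicE memNset ?mule0//= /level/= Dk.
  by apply/negP; rewrite -ltnNge.
rewrite -sumEFin !big_nat; apply: eq_bigr => n /andP[_ nk].
by rewrite indicE mem_set ?mule1// /level /= Dk.
Qed.

Let int_levels (g : nat -> R) delta t : 0 < delta -> (forall n, 0 <= g n) ->
  (\int[P]_w \sum_(n <oo) (g n)%:E * (\1_(level delta t n) w)%:E =
   \sum_(n <oo) (g n)%:E * P (level delta t n))%E.
Proof.
move=> d0 g0; rewrite integral_nneseries//; last 2 first.
- move=> n; apply: measurable_funeM; apply/measurable_EFinP/measurable_indic.
  exact: measurable_level.
- by move=> n w _; rewrite mule_ge0 ?lee_fin.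
apply: eq_eseriesr => n _; rewrite ge0_integralZl ?lee_fin//; last first.
  exact/measurable_EFinP/measurable_indic/measurable_level.
by rewrite integral_indic ?setIT//; exact: measurable_level.
Qed.

Lemma measurable_sum_levels (g : nat -> R) delta t :
  0 < delta -> (forall n, 0 <= g n) ->
  measurable_fun setT
    (fun w => \sum_(n <oo) (g n)%:E * (\1_(level delta t n) w)%:E)%E.
Proof.
move=> d0 g0; apply: ge0_emeasurable_sum => [n w _ _|n _].
  by rewrite mule_ge0 ?lee_fin.
apply: measurable_funeM; apply/measurable_EFinP/measurable_indic.
exact: measurable_level.
Qed.

(** A bound on [h] by partial sums of [g] along the grid integrates to a bound
    by the series of the probabilities of the levels, since almost every outcome
    belongs to exactly the first [k.+1] of them, for some [k]. *)
Lemma le_sum_levels (g : nat -> R) (h : R -> R) delta t :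
  0 < delta -> 0 <= t -> (forall n, 0 <= g n) ->
  measurable_fun setT h -> (forall y, 0 <= y -> 0 <= h y) ->
  (forall (k : nat) y, k%:R * delta <= y <= k.+1%:R * delta ->
    h y <= \sum_(0 <= n < k.+1) g n) ->
  (\int[P]_w (h (Y t w))%:E <= \sum_(n <oo) (g n)%:E * P (level delta t n))%E.
Proof.
move=> d0 t0 g0 mh h0 hg; rewrite -int_levels//.
apply: ae_ge0_le_integral => //.
- by move=> w _; rewrite lee_fin h0// first_passage_ge0.
- by apply/measurable_EFinP; exact: measurableT_comp.
- by move=> w _; apply: nneseries_ge0 => n _ _; rewrite mule_ge0 ?lee_fin.
- exact: measurable_sum_levels.
have := ae_crosses stD t; apply: filterS => w ct _.
have [k [Dk kY]] := level_index d0 t0 ct.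
by rewrite (sum_levels _ Dk) lee_fin hg.
Qed.

Lemma ge_sum_levels (g : nat -> R) (h : R -> R) delta t :
  0 < delta -> 0 <= t -> (forall n, 0 <= g n) ->
  measurable_fun setT h -> (forall y, 0 <= y -> 0 <= h y) ->
  (forall (k : nat) y, k%:R * delta <= y <= k.+1%:R * delta ->
    \sum_(0 <= n < k.+1) g n <= h y) ->
  (\sum_(n <oo) (g n)%:E * P (level delta t n) <= \int[P]_w (h (Y t w))%:E)%E.
Proof.
move=> d0 t0 g0 mh h0 hg; rewrite -int_levels//.
apply: ae_ge0_le_integral => //.
- by move=> w _; apply: nneseries_ge0 => n _ _; rewrite mule_ge0 ?lee_fin.
- exact: measurable_sum_levels.
- by move=> w _; rewrite lee_fin h0// first_passage_ge0.
- by apply/measurable_EFinP; exact: measurableT_comp.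
have := ae_crosses stD t; apply: filterS => w ct _.
have [k [Dk kY]] := level_index d0 t0 ct.
by rewrite (sum_levels _ Dk) lee_fin hg.
Qed.

Lemma sum1 k : \sum_(0 <= n < k) (1 : R) = k%:R.
Proof. by rewrite sumr_const_nat subn0. Qed.

Lemma sumr_nat_id k : \sum_(0 <= n < k.+1) (n%:R : R) = k%:R * k.+1%:R / 2.
Proof.
elim: k => [|k IH]; first by rewrite big_nat1 !mul0r.
by rewrite big_nat_recr//= IH -[k.+2%:R]natr1 -natr1; field.
Qed.

(** The grid of mesh 1 bounds Y_t^2 by the sum of the 2 n + 1 over the [n] with
    D n <= t, and P (D n <= t) <= e^t 2^-n. *)
Lemma first_passage_sqr_lty t : 0 <= t -> (\int[P]_w (Y t w ^+ 2)%:E < +oo)%E.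
Proof.
move=> t0; apply: (@le_lt_trans _ _ (\sum_(n <oo) ((2 * n%:R + 1)%:E * P (level 1 t n)))%E).
  apply: (le_sum_levels (h := fun y => y ^+ 2)) => //.
  - by move=> y _; exact: sqr_ge0.
  move=> k y; rewrite !mulr1 => /andP[ky yk].
  rewrite big_split/= -mulr_sumr sumr_nat_id sum1.
  rewrite (_ : _ + _ = k.+1%:R ^+ 2); last by rewrite -natr1; field.
  by rewrite ler_sqr ?nnegrE// (le_trans _ ky).
apply: (@le_lt_trans _ _ (6 * expR t)%:E); last by rewrite ltry.
apply: lime_le.
  by apply: is_cvg_nneseries => n _ _; rewrite mule_ge0 ?lee_fin ?measure_ge0//.
apply: nearW => N.
apply: (@le_trans _ _ (\sum_(0 <= n < N) ((2 * n%:R + 1) * (2^-1 ^+ n * expR t)))%:E).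
  rewrite -sumEFin; apply: lee_sum => n _; rewrite EFinM lee_pmul2l//.
  (* e^(t - n) <= e^t 2^-n *)
  apply: le_trans (level_upper stD t _) _; first by rewrite mulr_ge0.
  rewrite lee_fin mulr1 expRD mulrC ler_wpM2r ?expR_ge0//.
  rewrite -mulrN1 expRM_natl expRN lerXn2r ?nnegrE ?invr_ge0 ?expR_ge0//.
  by rewrite lef_pV2 ?posrE ?expR_gt0// (le_trans _ (expR_ge1Dx _)).
rewrite lee_fin.
have H M : \sum_(0 <= n < M) ((2 * n%:R + 1) * (2^-1 ^+ n * expR t)) =
    (6 - (4 * M%:R + 6) * 2^-1 ^+ M) * expR t :> R.
  elim: M => [|M IH]; first by rewrite big_geq// expr0; lra.
  by rewrite big_nat_recr//= IH exprS -natr1; field.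
rewrite H ler_pM2r ?expR_gt0// gerBl mulr_ge0 ?addr_ge0 ?mulr_ge0//.
Qed.

End grid_sums.

Section joint_grid_sums.
Context {R : realType} {d : measure_display} {T : measurableType d}.
Variables (P : probability T R) (D : R -> T -> R) (alpha : R).
Hypothesis stD : stable_subordinator P alpha D.

Let subD : subordinator P D. Proof. by case: stD. Qed.
Let Y := first_passage D.
Let mY t : measurable_fun setT (Y t) := measurable_first_passage subD t.
Let Y0 t w : 0 <= Y t w := first_passage_ge0 D t w.

Lemma first_passage_Lfun2 t : 0 <= t -> Y t \in Lfun P 2%:E.
Proof.
by move=> t0; apply: Lfun2_sqr_integrable => //; exact: first_passage_sqr_lty stD t t0.
Qed.

Let u t := fine 'E_P[Y t]%E.
Let q s t := fine 'E_P[Y s \* Y t]%E.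

Let uE t : 0 <= t -> (\int[P]_w (Y t w)%:E)%E = (u t)%:E.
Proof.
by move=> t0; rewrite /u -(Lfun1_EFin (Lfun21 (first_passage_Lfun2 t0))) unlock.
Qed.

Let qE s t : 0 <= s -> 0 <= t -> (\int[P]_w (Y s w * Y t w)%:E)%E = (q s t)%:E.
Proof.
move=> s0 t0.
rewrite /q -Lfun1_EFin ?unlock//.
exact: Lfun2_mul_Lfun1 (first_passage_Lfun2 s0) (first_passage_Lfun2 t0).
Qed.

Let u0 t : 0 <= u t.
Proof. by rewrite fine_ge0// expectation_ge0. Qed.

Variable delta : R.
Hypothesis d0 : 0 < delta.
Let L := level D delta.
Let mL t n : measurable (L t n) := measurable_level stD t n d0.

Let a t := fine (\sum_(n <oo) delta%:E * P (L t n))%E.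

Let grid_mean t : 0 <= t ->
  (\sum_(n <oo) delta%:E * P (L t n))%E = (a t)%:E /\ u t <= a t <= u t + delta.
Proof.
move=> t0; have sumd k : \sum_(0 <= n < k) delta = k%:R * delta.
  by rewrite sumr_const_nat subn0 mulr_natl.
have lo := le_sum_levels stD (g := fun=> delta) (h := id) d0 t0 (fun=> ltW d0).
have {}lo : ((u t)%:E <= \sum_(n <oo) delta%:E * P (L t n))%E.
  rewrite -uE//; apply: lo => // k y /andP[_]; by rewrite sumd.
have hi := ge_sum_levels stD (g := fun=> delta) (h := fun y => y + delta) d0 t0
  (fun=> ltW d0).
have {}hi : (\sum_(n <oo) delta%:E * P (L t n) <= (u t + delta)%:E)%E.
  rewrite EFinD -uE//.
  have -> : (\int[P]_w (Y t w)%:E + delta%:E = \int[P]_w (Y t w + delta)%:E)%E.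
    under [RHS]eq_integral do rewrite EFinD.
    rewrite ge0_integralD//; last 3 first.
    + by move=> w _; rewrite lee_fin.
    + exact/measurable_EFinP.
    + by move=> w _; rewrite lee_fin ltW.
    by congr (_ + _)%E; have := expectation_cst P delta; rewrite unlock => /esym.
  apply: hi => //.
  - exact: measurable_funD.
  - by move=> y y0; rewrite addr_ge0// ltW.
  - by move=> k y /andP[ky _]; rewrite sumd -natr1 mulrDl mul1r lerD2r.
have fin : (\sum_(n <oo) delta%:E * P (L t n))%E \is a fin_num.
  by rewrite ge0_fin_numE ?(le_lt_trans hi) ?ltry// (le_trans _ lo)// lee_fin.
have aE : (\sum_(n <oo) delta%:E * P (L t n))%E = (a t)%:E by rewrite /a fineK.
by split; [exact: aE | apply/andP; split; rewrite -lee_fin -aE].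
Qed.

Let level_before s t n m : s <= t -> (m <= n)%N -> L s n `&` L t m = L s n.
Proof.
move=> st mn; apply/setIidPl => w; rewrite /L /level /= => Ds.
apply: le_trans (le_trans Ds st); apply: (subordinator_nondecreasing subD).
  by rewrite mulr_ge0// ltW.
by rewrite ler_pM2r// ler_nat.
Qed.

Let increment n j x : P (L x j) =
  P [set w | D ((j + n)%:R * delta) w - D (n%:R * delta) w <= x].
Proof.
have := subordinator_stationary_increments subD (s := n%:R * delta)
  (t := (j + n)%:R * delta).
have n0 : 0 <= n%:R * delta by rewrite mulr_ge0// ltW.
move=> /(_ n0); rewrite ler_pM2r// ler_nat leq_addl => /(_ isT `]-oo, x]%classic).
rewrite -mulrBl natrD addrK => /(_ (measurable_itv _)) H.
transitivity (P [set w | `]-oo, x]%classic (D (j%:R * delta) w)]).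
  by congr (P _); apply/seteqP; split=> w; rewrite /L /level /= in_itv.
by rewrite -H; congr (P _); apply/seteqP; split=> w; rewrite /= in_itv.
Qed.

Let increment_indep n j s x :
  P (L s n `&` [set w | D ((j + n)%:R * delta) w - D (n%:R * delta) w <= x]) =
  (P (L s n) * P (L x j))%E.
Proof.
rewrite (increment n j).
have n0 : 0 <= n%:R * delta by rewrite mulr_ge0// ltW.
have nj : n%:R * delta <= (j + n)%:R * delta by rewrite ler_pM2r// ler_nat leq_addl.
have := increment_independent_past (subordinator0 subD)
  (subordinator_independent_increments subD) n0 nj
  (measurable_itv `]-oo, s]) (measurable_itv `]-oo, x]).
have E1 : D (n%:R * delta) @^-1` `]-oo, s] = L s n.
  by apply/seteqP; split=> w; rewrite /L /level /= in_itv.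
have E2 : (fun w => D ((j + n)%:R * delta) w - D (n%:R * delta) w) @^-1` `]-oo, x] =
  [set w | D ((j + n)%:R * delta) w - D (n%:R * delta) w <= x].
  by apply/seteqP; split=> w; rewrite /= in_itv.
by rewrite E1 E2.
Qed.

Let mincrement n j x :
  measurable [set w | D ((j + n)%:R * delta) w - D (n%:R * delta) w <= x].
Proof.
apply: measurable_sublevel; apply: measurable_funB.
- by apply: subordinator_measurable subD _ _; rewrite mulr_ge0// ltW.
- by apply: subordinator_measurable subD _ _; rewrite mulr_ge0// ltW.
Qed.

Let level_after_le s t n j :
  (P (L s n `&` L t (j + n)%N) <= P (L s n) * P (L t j))%E.
Proof.
rewrite -(increment_indep n); apply: le_measure; rewrite ?inE.
- exact: measurableI.
- exact: measurableI.
move=> w [Ls Lt]; split=> //=; apply: le_trans Lt; rewrite gerBl.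
rewrite -(subordinator0 subD w); apply: (subordinator_nondecreasing subD) => //.
by rewrite mulr_ge0// ltW.
Qed.

Let level_after_ge s t n j :
  (P (L s n) * P (L (t - s) j) <= P (L s n `&` L t (j + n)%N))%E.
Proof.
rewrite -(increment_indep n); apply: le_measure; rewrite ?inE.
- exact: measurableI.
- exact: measurableI.
move=> w [Ls Lt]; split=> //; move: Ls Lt; rewrite /L /level /=; lra.
Qed.

Let pL s n := fine (P (L s n)).
Let pLE s n : P (L s n) = (pL s n)%:E.
Proof. by rewrite /pL fineK// fin_num_measure. Qed.
Let pL0 s n : 0 <= pL s n. Proof. by rewrite fine_ge0. Qed.

(* the double sum over the pairs of levels, times [delta^2], is computed row by
   row; the part m < n of a row is explicit, the part m >= n is bounded by
   independence of the increments *)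
Let row s t n := (\sum_(m <oo) (delta * delta)%:E * P (L s n `&` L t m))%E.

Let rowE s t n : s <= t -> row s t n = ((delta * delta * n%:R * pL s n)%:E +
  \sum_(j <oo) (delta * delta)%:E * P (L s n `&` L t (j + n)%N))%E.
Proof.
move=> st; have dd0 : 0 <= delta * delta by rewrite mulr_ge0// ltW.
rewrite /row (nneseries_split 0 n); last by move=> k _; rewrite mule_ge0.
rewrite add0n -(nneseries_addn n); last by move=> k; rewrite mule_ge0.
congr (_ + _)%E; rewrite big_nat.
under eq_bigr => m /andP[_ mn] do rewrite level_before 1?ltnW// pLE -EFinM.
rewrite -big_nat sumEFin sumr_const_nat subn0; congr (_%:E).
by rewrite -(mulr_natr (delta * delta * pL s n)) mulrAC.
Qed.

Let row_le s t n : s <= t -> 0 <= t ->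
  (row s t n <= (delta * delta * n%:R + delta * a t)%:E * P (L s n))%E.
Proof.
move=> st t0; have dd0 : 0 <= delta * delta by rewrite mulr_ge0// ltW.
rewrite rowE// pLE -EFinM mulrDl [in leRHS]EFinD leeD2l//.
have [at_ _] := grid_mean t0.
rewrite [leRHS](_ : _ =
    \sum_(j <oo) (delta * pL s n)%:E * (delta%:E * P (L t j)))%E; last first.
  rewrite nneseriesZl ?at_ -?EFinM ?mulrA//; first by congr (_%:E); ring.
  by move=> j _; rewrite mule_ge0// lee_fin ltW.
apply: lee_nneseries => j _.
  by rewrite mule_ge0.
apply: (@le_trans _ _ ((delta * delta)%:E * (P (L s n) * P (L t j)))%E).
  by rewrite lee_wpmul2l// level_after_le.
by rewrite !pLE -!EFinM lee_fin le_eqVlt; apply/orP; left; apply/eqP; ring.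
Qed.

Let row_ge s t n : s <= t ->
  ((delta * delta * n%:R + delta * a (t - s))%:E * P (L s n) <= row s t n)%E.
Proof.
move=> st; have dd0 : 0 <= delta * delta by rewrite mulr_ge0// ltW.
rewrite rowE// pLE -EFinM mulrDl [in leLHS]EFinD leeD2l//.
have ts0 : 0 <= t - s by rewrite subr_ge0.
have [at_ _] := grid_mean ts0.
rewrite [leLHS](_ : _ =
    \sum_(j <oo) (delta * pL s n)%:E * (delta%:E * P (L (t - s)%R j)))%E; last first.
  rewrite nneseriesZl ?at_ -?EFinM ?mulrA//; first by congr (_%:E); ring.
  by move=> j _; rewrite mule_ge0// lee_fin ltW.
apply: lee_nneseries => j _.
  by rewrite mule_ge0// ?lee_fin ?mulr_ge0 ?mule_ge0// ?lee_fin ltW.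
apply: (@le_trans _ _ ((delta * delta)%:E * (P (L s n) * P (L (t - s)%R j)))%E).
  by rewrite !pLE -!EFinM lee_fin le_eqVlt; apply/orP; left; apply/eqP; ring.
by rewrite lee_wpmul2l// level_after_ge.
Qed.

Let int_joint s t :
  (\int[P]_w \sum_(n <oo) \sum_(m <oo)
     ((delta * delta)%:E * (\1_(L s n `&` L t m) w)%:E) =
   \sum_(n <oo) row s t n)%E.
Proof.
have dd0 : 0 <= delta * delta by rewrite mulr_ge0// ltW.
have mLL n m : measurable (L s n `&` L t m) by exact: measurableI.
have mi n m : measurable_fun setT
    (fun w => (delta * delta)%:E * (\1_(L s n `&` L t m) w)%:E)%E.
  by apply: measurable_funeM; apply/measurable_EFinP/measurable_indic.
have i0 n m w : (0 <= (delta * delta)%:E * (\1_(L s n `&` L t m) w)%:E)%E.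
  by rewrite mule_ge0 ?lee_fin.
rewrite integral_nneseries//; last 2 first.
- by move=> n; apply: ge0_emeasurable_sum.
- by move=> n w _; apply: nneseries_ge0 => m _ _.
apply: eq_eseriesr => n _; rewrite integral_nneseries//.
apply: eq_eseriesr => m _; rewrite ge0_integralZl ?lee_fin//; last first.
  exact/measurable_EFinP/measurable_indic.
by rewrite integral_indic ?setIT.
Qed.

(* the double series is the product of the lengths of two grid intervals *)
Let joint_pointwise s t w k l :
  (forall n, (D (n%:R * delta) w <= s) = (n <= k)%N) ->
  (forall n, (D (n%:R * delta) w <= t) = (n <= l)%N) ->
  (\sum_(n <oo) \sum_(m <oo)
     ((delta * delta)%:E * (\1_(L s n `&` L t m) w)%:E) =
   (k.+1%:R * delta * (l.+1%:R * delta))%:E)%E.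
Proof.
move=> ks lt.
have sumd K : \sum_(0 <= n < K) delta = K%:R * delta.
  by rewrite sumr_const_nat subn0 mulr_natl.
have sum_s := sum_levels (fun=> delta) ks; rewrite sumd in sum_s.
have sum_t := sum_levels (fun=> delta) lt; rewrite sumd in sum_t.
rewrite [LHS](_ : _ = \sum_(n <oo)
    ((l.+1%:R * delta)%:E * (delta%:E * (\1_(L s n) w)%:E)))%E.
  rewrite nneseriesZl; last by move=> n _; rewrite -EFinM lee_fin mulr_ge0// ltW.
  by rewrite sum_s -EFinM mulrC.
apply: eq_eseriesr => n _.
transitivity (\sum_(m <oo) (delta * \1_(L s n) w)%:E * (delta%:E * (\1_(L t m) w)%:E))%E.
  by apply: eq_eseriesr => m _; rewrite indicI -!EFinM/=; congr (_%:E); ring.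
rewrite nneseriesZl; last by move=> m _; rewrite -EFinM lee_fin mulr_ge0// ltW.
by rewrite sum_t -!EFinM mulrC.
Qed.

Let int_quadratic s t (x y z c : R) : 0 <= s -> 0 <= t ->
  (\int[P]_w (x * (Y s w * Y t w) + y * Y s w + z * Y t w + c)%:E)%E =
  (x * q s t + y * u s + z * u t + c)%:E.
Proof.
move=> s0 t0; have s2 := first_passage_Lfun2 s0; have t2 := first_passage_Lfun2 t0.
have st := Lfun2_mul_Lfun1 s2 t2; have s1 := Lfun21 s2; have t1 := Lfun21 t2.
have E : 'E_P[((((x \o* (Y s \* Y t)) \+ (y \o* Y s)) \+ (z \o* Y t)) \+ cst c)%R]%E =
    (x * q s t + y * u s + z * u t + c)%:E.
  have sc (f : T -> R) r : f \in Lfun P 1 -> (r \o* f) \in Lfun P 1.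
    exact: Lfun_scale.
  rewrite !expectationD ?rpredD ?sc ?Lfun_cst// !expectationZl// expectation_cst.
  by rewrite (Lfun1_EFin st) (Lfun1_EFin s1) (Lfun1_EFin t1).
rewrite -E unlock; apply: eq_integral => w _ /=; congr (_%:E); ring.
Qed.

Let row_ge0 s t n : (0 <= row s t n)%E.
Proof.
apply: nneseries_ge0 => m _ _.
by rewrite mule_ge0 ?lee_fin ?mulr_ge0// ltW.
Qed.

Let joint_ge0 s t w : (0 <= \sum_(n <oo) \sum_(m <oo)
   ((delta * delta)%:E * (\1_(L s n `&` L t m) w)%:E))%E.
Proof.
apply: nneseries_ge0 => n _ _; apply: nneseries_ge0 => m _ _.
by rewrite mule_ge0 ?lee_fin ?mulr_ge0// ltW.
Qed.

Let measurable_joint s t : measurable_fun setT (fun w => \sum_(n <oo) \sum_(m <oo)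
   ((delta * delta)%:E * (\1_(L s n `&` L t m) w)%:E))%E.
Proof.
apply: ge0_emeasurable_sum => [n w _ _|n _].
  apply: nneseries_ge0 => m _ _.
  by rewrite mule_ge0 ?lee_fin ?mulr_ge0// ltW.
apply: ge0_emeasurable_sum => [m w _ _|m _].
  by rewrite mule_ge0 ?lee_fin ?mulr_ge0// ltW.
apply: measurable_funeM; apply/measurable_EFinP/measurable_indic.
exact: measurableI.
Qed.

Let a_ge0 t : 0 <= a t.
Proof.
by rewrite fine_ge0// nneseries_ge0// => n _ _; rewrite mule_ge0// lee_fin ltW.
Qed.

Let grid_ge0 n : 0 <= n%:R * delta.
Proof. by rewrite mulr_ge0// ltW. Qed.

Let sum_affine k x : \sum_(0 <= n < k.+1) (delta * delta * n%:R + delta * x) =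
  k%:R * delta * (k.+1%:R * delta) / 2 + k.+1%:R * delta * x.
Proof.
rewrite big_split/= sumr_const_nat subn0 -mulr_sumr sumr_nat_id.
by rewrite -(mulr_natl (delta * x)) mulrA; field.
Qed.

(** In the last step the row sums add up to z (z + delta) / 2 + (z + delta) a,
    where z = k delta and a is the grid approximation of E Y_t; as z <= Y_s,
    this is at most the quadratic function [h] of Y_s. *)
Lemma moment_product_le s t : 0 <= s -> s <= t ->
  q s t <= (q s s + delta * u s) / 2 + (u t + delta) * (u s + delta).
Proof.
move=> s0 st; have t0 := le_trans s0 st.
have [_ /andP[_ at_le]] := grid_mean t0.
have step1 : ((q s t)%:E <= \sum_(n <oo) row s t n)%E.
  rewrite -qE// -int_joint; apply: ae_ge0_le_integral => //.
  - by move=> w _; rewrite lee_fin mulr_ge0.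
  - exact/measurable_EFinP/measurable_funM.
  have := ae_crosses stD t; have := ae_crosses stD s; apply: filterS2 => w cs ct _.
  have [k [Dk /andP[_ kY]]] := level_index stD d0 s0 cs.
  have [l [Dl /andP[_ lY]]] := level_index stD d0 t0 ct.
  by rewrite (joint_pointwise Dk Dl) lee_fin ler_pM.
have step2 : (\sum_(n <oo) row s t n <=
    \sum_(n <oo) (delta * delta * n%:R + delta * a t)%:E * P (L s n))%E.
  by apply: lee_nneseries => [n _ _|n _]; [exact: row_ge0|exact: row_le].
pose h y := 2^-1 * (y * y) + (delta / 2 + a t) * y + 0 * y + a t * delta.
have step3 := ge_sum_levels stD (h := h) d0 s0.
rewrite -lee_fin; apply: le_trans step1 (le_trans step2 _).
apply: le_trans (step3 _ _ _ _ _) _.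
- by move=> n; rewrite addr_ge0 ?mulr_ge0// ltW.
- by do !apply: measurable_funD => //; do !apply: measurable_funM => //.
- by move=> y y0; rewrite /h mul0r addr0 !addr_ge0 ?mulr_ge0 ?addr_ge0 ?divr_ge0// ltW.
- move=> k y /andP[ky _]; rewrite sum_affine -natr1 mulrDl mul1r /h.
  have := grid_ge0 k; have := a_ge0 t; have := d0.
  move: (a t) (k%:R * delta) ky => x z zy; nra.
rewrite int_quadratic// lee_fin.
have := a_ge0 t; have := u0 s; move: at_le; have := d0; nra.
Qed.

(** Here a is the grid approximation of E Y_(t-s), and Y_s <= z + delta bounds
    the same expression from below by a function of Y_s.  Its first term is negative for Y_s < delta and is cut off
    at 0 there, so that the integrands stay nonnegative. *)
Lemma moment_product_ge s t : 0 <= s -> s <= t ->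
  q s s / 2 + u (t - s) * u s <=
  q s t + delta * (u s + u t) + delta * delta + delta / 2 * u s.
Proof.
move=> s0 st; have t0 := le_trans s0 st.
have ts0 : 0 <= t - s by rewrite subr_ge0.
have [_ /andP[a_ge _]] := grid_mean ts0.
have step1 : (\sum_(n <oo) row s t n <=
    (q s t + delta * u s + delta * u t + delta * delta)%:E)%E.
  rewrite -[q s t]mul1r -int_quadratic// -int_joint; apply: ae_ge0_le_integral => //.
  - by move=> w _; rewrite lee_fin !addr_ge0 ?mulr_ge0// ltW.
  - apply/measurable_EFinP.
    by do !apply: measurable_funD => //; do !apply: measurable_funM => //.
  have := ae_crosses stD t; have := ae_crosses stD s; apply: filterS2 => w cs ct _.
  have [k [Dk /andP[kY _]]] := level_index stD d0 s0 cs.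
  have [l [Dl /andP[lY _]]] := level_index stD d0 t0 ct.
  rewrite (joint_pointwise Dk Dl) lee_fin.
  have kY1 : k.+1%:R * delta <= Y s w + delta by rewrite -natr1 mulrDl mul1r lerD2r.
  have lY1 : l.+1%:R * delta <= Y t w + delta by rewrite -natr1 mulrDl mul1r lerD2r.
  apply: le_trans (ler_pM (grid_ge0 _) (grid_ge0 _) kY1 lY1) _.
  by rewrite le_eqVlt; apply/orP; left; apply/eqP; ring.
have step2 : (\sum_(n <oo) (delta * delta * n%:R + delta * a (t - s))%:E * P (L s n)
    <= \sum_(n <oo) row s t n)%E.
  apply: lee_nneseries => [n _ _|n _]; last exact: row_ge.
  by rewrite mule_ge0 ?lee_fin ?addr_ge0 ?mulr_ge0// ltW.
pose h y := Num.max 0 (2^-1 * (y * (y - delta))) + a (t - s) * y.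
have h0 y : 0 <= y -> 0 <= h y.
  by move=> y0; rewrite addr_ge0 ?mulr_ge0// le_max lexx.
have mh : measurable_fun setT h.
  apply: measurable_funD; last exact: measurable_funM.
  apply: measurable_maxr => //; apply: measurable_funM => //.
  by apply: measurable_funM => //; exact: measurable_funB.
have step3 : (\int[P]_w (h (Y s w))%:E <=
    (q s t + delta * u s + delta * u t + delta * delta)%:E)%E.
  apply: le_trans (le_trans step2 step1).
  apply: (le_sum_levels stD (h := h) d0 s0) => //.
    by move=> n; rewrite addr_ge0 ?mulr_ge0// ltW.
  move=> k y /andP[ky yk]; rewrite sum_affine /h.
  rewrite lerD//; last by rewrite mulrC ler_wpM2r.
  rewrite ge_max; apply/andP; split; first by rewrite !mulr_ge0 ?invr_ge0// ltW.
  have := grid_ge0 k; have := d0; move: yk; rewrite -natr1 mulrDl mul1r.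
  move: (k%:R * delta) ky => z zy yz dp z0.
  have zz : 0 <= z * (z + delta) by apply: mulr_ge0; lra.
  have [yd|yd] := leP y delta.
    have : y * (y - delta) <= 0 by apply: mulr_ge0_le0; lra.
    by move: (y * (y - delta)) (z * (z + delta)) zz => v v'; lra.
  move: zz; rewrite mulrC.
  have : y * (y - delta) <= (z + delta) * z by apply: ler_pM; lra.
  by move: (y * (y - delta)) ((z + delta) * z) => v v'; lra.
have step4 : ((2^-1 * q s s + a (t - s) * u s)%:E <=
    \int[P]_w (h (Y s w))%:E + (delta / 2 * u s)%:E)%E.
  rewrite (_ : 2^-1 * _ + _ = 2^-1 * q s s + a (t - s) * u s + 0 * u s + 0); last by ring.
  rewrite (_ : delta / 2 * u s = 0 * q s s + delta / 2 * u s + 0 * u s + 0); last by ring.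
  rewrite -!int_quadratic// -ge0_integralD//.
  - apply: ge0_le_integral => //.
    + by move=> w _; rewrite lee_fin !addr_ge0 ?mulr_ge0.
    + apply/measurable_EFinP.
      by do !apply: measurable_funD => //; do !apply: measurable_funM => //.
    + apply: emeasurable_funD; apply/measurable_EFinP.
        exact: measurableT_comp.
      by do !apply: measurable_funD => //; do !apply: measurable_funM => //.
    + move=> w _; rewrite -EFinD lee_fin /h.
      have : 2^-1 * (Y s w * (Y s w - delta)) <=
          Num.max 0 (2^-1 * (Y s w * (Y s w - delta))) by rewrite le_max lexx orbT.
      by move: (Num.max 0 (2^-1 * (Y s w * (Y s w - delta)))) (Y s w) => z y; lra.
  - by move=> w _; rewrite lee_fin h0.
  - by apply/measurable_EFinP; exact: measurableT_comp.
  - by move=> w _; rewrite lee_fin !addr_ge0 ?mulr_ge0 ?divr_ge0// ltW.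
  - apply/measurable_EFinP.
    by do !apply: measurable_funD => //; do !apply: measurable_funM => //.
have := le_trans step4 (leeD2r _ step3).
rewrite -EFinD lee_fin.
have := u0 s; move: a_ge; nra.
Qed.

End joint_grid_sums.

(** * Laplace transforms and laws *)

Section powers.
Context {R : realType}.

(** Bernoulli's inequality *)
Lemma one_minus_expn_ge (e : R) N : 0 <= e <= 1 -> 1 - N%:R * e <= (1 - e) ^+ N.
Proof.
move=> /andP[e0 e1]; elim: N => [|N IH]; first by rewrite mul0r subr0 expr0.
rewrite exprS; apply: (@le_trans _ _ ((1 - e) * (1 - N%:R * e))).
  rewrite -natr1; have : 0 <= N%:R :> R by []; nra.
by rewrite ler_wpM2l// subr_ge0.
Qed.

(** 1 - e <= exp (- z), whence the power is at most 1 / exp (N z), and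
    exp (N z) >= N z. *)
Lemma one_minus_expn_le (z e : R) N : 0 < N%:R :> R -> 0 < z -> z <= e <= 1 ->
  (1 - e) ^+ N <= (N%:R * z)^-1.
Proof.
move=> N0 z0 /andP[ze e1].
have Nz : 0 < N%:R * z by rewrite mulr_gt0.
have e_exp : 1 - e <= expR (- z).
  by apply: le_trans (expR_ge1Dx _); rewrite lerD2l lerN2.
apply: (@le_trans _ _ (expR (- z) ^+ N)).
  by rewrite lerXn2r ?nnegrE ?expR_ge0// subr_ge0.
rewrite -expRM_natl mulrN expRN lef_pV2 ?posrE ?expR_gt0//.
by apply: le_trans (expR_ge1Dx _); rewrite lerDr.
Qed.

End powers.

Section laplace_order.
Context {R : realType} {d : measure_display} {T : measurableType d}.
Variable P : probability T R.
Variables X X' : T -> R.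
Hypotheses (mX : measurable_fun setT X) (mX' : measurable_fun setT X').
Hypotheses (X0 : forall w, 0 <= X w) (X'0 : forall w, 0 <= X' w).
Hypothesis XX' : forall s, 0 < s ->
  'E_P[fun w => (expR (- s * X w))%R]%E = 'E_P[fun w => (expR (- s * X' w))%R]%E.

Let ex (s : R) (V : T -> R) (w : T) : R := expR (- s * V w).

(* the factor [ex s V] serves the induction on [N]: it makes
   F s r N.+1 the difference of F s r N and F (s + r) r N *)
Let F (s r : R) N V w : R := ex s V w * (1 - ex r V w) ^+ N.

Let mex s V : measurable_fun setT V -> measurable_fun setT (ex s V).
Proof. by move=> mV; apply: measurableT_comp => //; exact: measurable_funM. Qed.

Let ex01 s V w : 0 <= s -> 0 <= V w -> 0 < ex s V w <= 1.
Proof.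
move=> s0 V0; rewrite expR_gt0 /= expR_le1 mulNr oppr_le0; exact: mulr_ge0.
Qed.

Let mF s r N V : measurable_fun setT V -> measurable_fun setT (F s r N V).
Proof.
move=> mV; apply: measurable_funM; first exact: mex.
by apply: measurable_funX; apply: measurable_funB => //; exact: mex.
Qed.

Let F01 s r N V w : 0 <= s -> 0 <= r -> 0 <= V w -> 0 <= F s r N V w <= 1.
Proof.
move=> s0 r0 V0.
have /andP[/ltW es0 es1] := ex01 s0 V0; have /andP[er0 er1] := ex01 r0 V0.
have e0 : 0 <= 1 - ex r V w by lra.
have e1 : 1 - ex r V w <= 1 by lra.
by rewrite mulr_ge0 ?exprn_ge0//= mulr_ile1 ?exprn_ge0// exprn_ile1.
Qed.

Let FL s r N (V : T -> R) : measurable_fun setT V -> (forall w, 0 <= V w) ->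
  0 <= s -> 0 <= r -> F s r N V \in Lfun P 1.
Proof.
move=> mV V0 s0 r0; apply: (@Lfun1_bounded _ _ _ P _ 1); first exact: mF.
by move=> w; have /andP[F0 F1] := F01 N s0 r0 (V0 w); rewrite ger0_norm.
Qed.

Let E_F s r N : 0 <= s -> 0 < r -> 'E_P[F s r N X]%E = 'E_P[F s r N X']%E.
Proof.
elim: N s => [|N IH] s s0 r0.
  have E0 V : F s r 0 V = ex s V by apply/funext => w; rewrite /F expr0 mulr1.
  rewrite !E0; move: s0; rewrite le_eqVlt => /predU1P[<-|]; last exact: XX'.
  suff E1 V : ex 0 V = cst 1 by rewrite !E1.
  by apply/funext => w; rewrite /ex oppr0 mul0r expR0.
have ES V : F s r N.+1 V = F s r N V \- F (s + r) r N V.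
  apply/funext => w; rewrite /F /= exprS.
  rewrite (_ : ex (s + r) V w = ex s V w * ex r V w); first by ring.
  by rewrite /ex opprD mulrDl expRD.
have r0' := ltW r0.
have sr0 : 0 <= s + r by rewrite addr_ge0.
rewrite (ES X) (ES X').
rewrite (expectationB (FL N mX X0 s0 r0') (FL N mX X0 sr0 r0')).
rewrite (expectationB (FL N mX' X'0 s0 r0') (FL N mX' X'0 sr0 r0')).
by rewrite (IH s s0 r0) (IH (s + r) sr0 r0).
Qed.

(** The Laplace transform gives the expectation of every polynomial in
    [y = e^(- theta X)].  The polynomials [(1 - y ^+ n) ^+ (2 ^ n)] tend to 0
    where [y > 1/2] and to 1 where [y < 1/2]; choosing [theta] such that
    [y = 1/2] at the midpoint of [a] and [b] they separate X <= a from b < X. *)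
Lemma laplace_cdf_le a b : 0 < a -> a < b ->
  (P [set w | (X w <= a)%R] <= P [set w | (X' w <= b)%R])%E.
Proof.
move=> a0 ab.
pose theta := ln 2 / ((a + b) / 2).
have c0 : 0 < (a + b) / 2 by lra.
have ln2 : 0 < ln 2 :> R by rewrite ln_gt0// ltr1n.
have th0 : 0 < theta by rewrite divr_gt0.
have half : expR (- ln 2) = 2^-1 :> R by rewrite expRN lnK// posrE.
have thc : theta * ((a + b) / 2) = ln 2 by rewrite /theta mulfVK// gt_eqF.
pose x := 2 * expR (- theta * a); pose y := 2 * expR (- theta * b).
have x1 : 1 < x.
  rewrite /x -ltr_pdivrMl// mulr1 -half ltr_expR mulNr ltrN2 -thc ltr_pM2l//; lra.
have y1 : y < 1.
  rewrite /y -ltr_pdivlMl// mulr1 -half ltr_expR mulNr ltrN2 -thc ltr_pM2l//; lra.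
have y0 : 0 <= y by rewrite mulr_ge0// expR_ge0.
have mXa := measurable_sublevel a mX; have mX'b := measurable_sublevel b mX'.
set A := [set w | X w <= a] in mXa *; set B := [set w | X' w <= b] in mX'b *.
have mI (C : set T) : measurable C -> measurable_fun setT (\1_C : T -> R).
  exact: measurable_indic.
have upper n : (0 < n)%N ->
    ('E_P[F 0 (n%:R * theta) (2 ^ n) X] <= (x^-1 ^+ n)%:E + P (~` A))%E.
  move=> n0; rewrite -(expectation_cst P (x^-1 ^+ n)) -(expectation_indic P (measurableC mXa)).
  have xn0 : 0 <= x^-1 ^+ n by rewrite exprn_ge0// invr_ge0 (le_trans _ (ltW x1)).
  rewrite -expectationD ?Lfun_cst//; last exact/Lfun1_indic/measurableC.
  have r0 : 0 <= n%:R * theta by rewrite mulr_ge0// ltW.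
  apply: expectation_le.
  - exact: mF.
  - by apply: measurable_funD => //; exact/mI/measurableC.
  - by move=> w; case/andP: (F01 (2 ^ n) (lexx 0) r0 (X0 w)).
  - by move=> w; rewrite addr_ge0.
  apply/aeW => w /=; rewrite indicE.
  have [Aw|Aw] := pselect (A w); last first.
    rewrite mem_set//=; apply: (@le_trans _ _ 1); last by rewrite lerDr.
    by case/andP: (F01 (2 ^ n) (lexx 0) r0 (X0 w)).
  rewrite memNset//= addr0.
  have /andP[e0 e1] := ex01 r0 (X0 w).
  have zle : expR (- theta * a) ^+ n <= ex (n%:R * theta) X w.
    rewrite -expRM_natl ler_expR !mulNr mulrN lerN2 mulrA ler_wpM2l//.
  have z0 : 0 < expR (- theta * a) ^+ n by rewrite exprn_gt0// expR_gt0.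
  have -> : x^-1 ^+ n = ((2 ^ n)%:R * expR (- theta * a) ^+ n)^-1.
    by rewrite natrX -exprMn exprVn.
  have F0 : ex 0 X w = 1 by rewrite /ex oppr0 mul0r expR0.
  have N0 : 0 < (2 ^ n)%:R :> R by rewrite ltr0n expn_gt0.
  by rewrite /F F0 mul1r; apply: one_minus_expn_le; rewrite ?zle ?e1.
have lower n : (0 < n)%N ->
    ((1 - y ^+ n)%:E * P (~` B) <= 'E_P[F 0 (n%:R * theta) (2 ^ n) X'])%E.
  move=> n0; have mB' := measurableC mX'b.
  rewrite -(expectation_indic P mB') -expectationZl; last exact: Lfun1_indic.
  have r0 : 0 <= n%:R * theta by rewrite mulr_ge0// ltW.
  have yn1 : y ^+ n <= 1 by rewrite exprn_ile1// ltW.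
  apply: expectation_le.
  - by apply: measurable_funM => //; exact: mI.
  - exact: mF.
  - by move=> w; rewrite mulr_ge0// subr_ge0.
  - by move=> w; case/andP: (F01 (2 ^ n) (lexx 0) r0 (X'0 w)).
  apply/aeW => w /=; rewrite indicE.
  have [Bw|Bw] := pselect (B w).
    rewrite memNset//= mul0r.
    by case/andP: (F01 (2 ^ n) (lexx 0) r0 (X'0 w)).
  rewrite mem_set//= mul1r.
  have /andP[e0 e1] := ex01 r0 (X'0 w).
  have F0 : ex 0 X' w = 1 by rewrite /ex oppr0 mul0r expR0.
  rewrite /F F0 mul1r; apply: le_trans (one_minus_expn_ge _ _); last first.
    by rewrite ltW.
  rewrite lerB// /y exprMn natrX ler_wpM2l ?exprn_ge0//.
  rewrite -expRM_natl ler_expR !mulNr mulrN lerN2 mulrA ler_wpM2l//.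
  by move/negP: Bw; rewrite -ltNge => /ltW.
have key n : (0 < n)%N -> (1 - y ^+ n) * fine (P (~` B)) <= x^-1 ^+ n + fine (P (~` A)).
  have mA' := measurableC mXa; have mB' := measurableC mX'b.
  move=> n0; rewrite -lee_fin EFinM [in leRHS]EFinD !fineK ?fin_num_measure//.
  have r0 : 0 < n%:R * theta by rewrite mulr_gt0// ltr0n.
  apply: le_trans (lower _ n0) _; rewrite -(E_F (2 ^ n) (lexx 0) r0).
  exact: upper.
have BA : fine (P (~` B)) <= fine (P (~` A)).
  have cl : (1 - y ^+ n) * fine (P (~` B)) @[n --> \oo] --> (1 - 0) * fine (P (~` B)).
    apply: cvgM; last exact: cvg_cst.
    apply: cvgB; first exact: cvg_cst.
    by apply: cvg_expr; rewrite ger0_norm.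
  have cr : x^-1 ^+ n + fine (P (~` A)) @[n --> \oo] --> 0 + fine (P (~` A)).
    apply: cvgD; last exact: cvg_cst.
    have x0 : 0 < x by rewrite (lt_trans _ x1).
    by apply: cvg_expr; rewrite ger0_norm ?invf_lt1// invr_ge0 ltW.
  rewrite -[X in X <= _]mul1r -[X in X * _]subr0 -[X in _ <= X]add0r.
  apply: (ler_cvg_to cl cr); exists 1%N => // n /= n0; exact: key.
have PC (C : set T) : measurable C -> fine (P (~` C)) = 1 - fine (P C).
  move=> mC; rewrite probability_setC//.
  by rewrite -[P C]fineK ?fin_num_measure.
rewrite -[P A]fineK ?fin_num_measure// -[P B]fineK ?fin_num_measure// lee_fin.
by move: BA; rewrite !PC//; lra.
Qed.

End laplace_order.

(** * Self-similarity of the passage times *)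

Lemma powRV {R : realType} (x r : R) : 0 < x -> x^-1 `^ r = (x `^ r)^-1.
Proof.
move=> x0; apply: (mulIf (x := x `^ r)); first by rewrite gt_eqF ?powR_gt0.
rewrite -powRM ?invr_ge0 ?ltW// mulVf ?gt_eqF// powR1 mulVf//.
by rewrite gt_eqF ?powR_gt0.
Qed.

Section stochastic_order.
Context {R : realType} {d : measure_display} {T : measurableType d}.
Variable P : probability T R.

(** The expectation of a nonnegative variable is the integral of its tail
    probabilities. *)
Lemma stochastic_order_expectation_le (X X' : T -> R) :
  measurable_fun setT X -> measurable_fun setT X' ->
  (forall w, 0 <= X w) -> (forall w, 0 <= X' w) ->
  (forall r, 0 <= r -> (P [set w | (r < X w)%R] <= P [set w | (r < X' w)%R])%E) ->
  ('E_P[X] <= 'E_P[X'])%E.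
Proof.
move=> mX mX' X0 X'0 XX'.
pose fX : {RV P >-> R} := mfun_Sub (mem_set mX).
pose fX' : {RV P >-> R} := mfun_Sub (mem_set mX').
rewrite -[X]/(fX : T -> R) -[X']/(fX' : T -> R) !ge0_expectation_ccdf//.
have ccdfE (V : {RV P >-> R}) r : ccdf V r = P [set w | r < V w].
  by congr (P _); apply/seteqP; split=> w; rewrite /= in_itv/= andbT.
apply: ge0_le_integral => //.
- by apply: measurable_funTS; exact: ccdf_measurable.
- by apply: measurable_funTS; exact: ccdf_measurable.
- by move=> r; rewrite /= in_itv/= andbT => r0; rewrite !ccdfE; exact: XX'.
Qed.

End stochastic_order.

Section self_similarity.
Context {R : realType} {d : measure_display} {T : measurableType d}.
Variables (P : probability T R) (D : R -> T -> R) (alpha : R).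
Hypothesis stD : stable_subordinator P alpha D.
Hypothesis alpha0 : 0 < alpha.

Let subD : subordinator P D. Proof. by case: stD. Qed.
Let Y := first_passage D.
Let mY t : measurable_fun setT (Y t) := measurable_first_passage subD t.
Let Y0 t w : 0 <= Y t w := first_passage_ge0 D t w.
Let mD r : 0 <= r -> measurable_fun setT (D r).
Proof. exact: subordinator_measurable subD r. Qed.
Let D_ge0 r w : 0 <= r -> 0 <= D r w.
Proof.
move=> r0; rewrite -(subordinator0 subD w).
exact: subordinator_nondecreasing subD w 0 r (lexx 0) r0.
Qed.

(* D r and D (x^alpha r) / x have the Laplace transform exp (- r s^alpha); the
   room between [a] and [b] is the one left by [laplace_cdf_le] *)
Let level_scaling x r a b : 0 < x -> 0 <= r -> 0 < a -> a < b ->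
  (P [set w | (D r w <= a)%R] <= P [set w | (D (x `^ alpha * r) w <= x * b)%R])%E.
Proof.
move=> x0 r0 a0 ab; have xr0 : 0 <= x `^ alpha * r by rewrite mulr_ge0// powR_ge0.
rewrite [X in (_ <= P X)%E](_ : _ = [set w | D (x `^ alpha * r) w / x <= b]); last first.
  by apply/seteqP; split=> w /=; rewrite ler_pdivrMr// (mulrC b).
apply: (laplace_cdf_le (X' := fun w => D (x `^ alpha * r) w / x)) a0 ab.
- exact: mD.
- by apply: measurable_funM => //; exact: mD.
- by move=> w; exact: D_ge0.
- by move=> w; rewrite divr_ge0 ?D_ge0// ltW.
move=> s s0; have [_ lapl] := stD.
rewrite lapl//.
rewrite [X in 'E_P[X]%E](_ : _ = fun w => expR (- (s / x) * D (x `^ alpha * r) w)).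
  rewrite lapl ?divr_gt0//; congr (expR _)%:E.
  rewrite powRM ?invr_ge0 ?ltW// powRV//.
  by field; rewrite gt_eqF ?powR_gt0.
by apply/funext => w; congr expR; rewrite !mulNr mulrAC mulrA.
Qed.

(* passages after [r] and levels at [r] differ on the boundary only, which is
   absorbed by the room between [t] and [t'] *)
Let passage_scaling x r t t' : 0 < x -> 0 <= r -> 0 < t -> t < t' ->
  (P [set w | (r < Y t w)%R] <= P [set w | (x `^ alpha * r < Y (x * t') w)%R])%E.
Proof.
move=> x0 r0 t0 tt'; have xr0 : 0 <= x `^ alpha * r by rewrite mulr_ge0// powR_ge0.
have mYr t1 r1 : measurable [set w | r1 < Y t1 w].
  rewrite [X in measurable X](_ : _ = Y t1 @^-1` `]r1, +oo[).
    by rewrite -[X in measurable X]setTI; exact: mY.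
  by apply/seteqP; split=> w; rewrite /= in_itv/= andbT.
pose t1 := (t + t') / 2.
have [tt1 t1t'] : t < t1 /\ t1 < t' by rewrite /t1; split; lra.
apply: (@le_trans _ _ (P [set w | D r w <= t])).
  apply: le_measure; rewrite ?inE//; first exact: measurable_le_level subD _ _ r0.
  by move=> w /=; exact: le_level.
apply: le_trans (level_scaling x0 r0 t0 tt1) _.
have [N [mN PN0 crossN]] := ae_crosses stD (x * t').
apply: (@le_trans _ _ (P ([set w | x `^ alpha * r < Y (x * t') w] `|` N))).
  apply: le_measure; rewrite ?inE.
  - exact: measurable_le_level subD _ _ xr0.
  - exact: measurableU.
  move=> w /= Dw; have [cw|ncw] := pselect (crosses D (x * t') w); last first.
    by right; apply: crossN.
  left; apply: (lt_first_passage subD xr0 _ cw Dw).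
  by rewrite ltr_pM2l.
rewrite -[leRHS]adde0 -[X in (_ <= _ + X)%E]PN0.
by apply: measureU2.
Qed.

Let u t := fine 'E_P[Y t]%E.
Let q t := fine 'E_P[Y t \* Y t]%E.

(* trades the strict inequality between the times of [passage_scaling] for a
   factor k > 1 in the moments, which then tends to 1 *)
Let le_of_factor (a b : R) : 0 <= b -> (forall k, 1 < k -> a <= k * b) -> a <= b.
Proof.
move=> b0 H; rewrite leNgt; apply/negP => ba.
move: b0; rewrite le_eqVlt => /predU1P[b0|b0].
  have := H 2 (ltac:(by rewrite ltr1n)); rewrite -b0 mulr0; lra.
have k1 : 1 < (1 + a / b) / 2.
  have : 1 < a / b by rewrite ltr_pdivlMr// mul1r.
  lra.
have := H _ k1; rewrite mulrAC ler_pdivlMr// mulrDl mul1r mulfVK ?gt_eqF//; lra.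
Qed.

Let passage_le c t a r : 0 < c -> 0 < t -> 0 < a -> t < c * a -> 0 <= r ->
  (P [set w | (r < Y t w)%R] <= P [set w | (r < c `^ alpha * Y a w)%R])%E.
Proof.
move=> c0 t0 a0 tca r0; have ci0 : 0 < c^-1 by rewrite invr_gt0.
have := passage_scaling ci0 r0 t0 tca; rewrite mulKf ?gt_eqF//.
congr (_ <= P _)%E; apply/seteqP; split=> w;
  by rewrite /= powRV// ltr_pdivrMl ?powR_gt0.
Qed.

(* the ratio of times that turns into the factor k under the power alpha *)
Let factor t a k : 0 < t -> 0 < a -> 1 < k ->
  let c := k `^ (alpha^-1) * (t / a) in
  [/\ 0 < c, t < c * a & c `^ alpha = k * (t / a) `^ alpha].
Proof.
move=> t0 a0 k1 c; have k0 := lt_trans ltr01 k1.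
have ta0 : 0 < t / a by rewrite divr_gt0.
split; first by rewrite mulr_gt0// powR_gt0.
  rewrite /c -mulrA mulfVK ?gt_eqF// ltr_pMl//.
  have p1 : 1 = 1 `^ (alpha^-1) :> R by rewrite powR1.
  rewrite [X in X < _]p1 gt0_ltr_powR ?invr_gt0//.
    by rewrite nnegrE.
  by rewrite nnegrE ltW.
rewrite /c powRM ?powR_ge0 ?ltW// -powRrM mulVf ?gt_eqF// powRr1// ltW//.
Qed.

Let uE t : 0 <= t -> 'E_P[Y t]%E = (u t)%:E.
Proof. by move=> t0; rewrite -Lfun1_EFin// Lfun21// (first_passage_Lfun2 stD). Qed.

Let qE t : 0 <= t -> 'E_P[Y t \* Y t]%E = (q t)%:E.
Proof.
move=> t0; rewrite -Lfun1_EFin//.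
by apply: Lfun2_mul_Lfun1; exact: (first_passage_Lfun2 stD).
Qed.

Let mean_le t a : 0 < t -> 0 < a -> u t <= (t / a) `^ alpha * u a.
Proof.
move=> t0 a0; apply: le_of_factor.
  by rewrite mulr_ge0 ?powR_ge0// fine_ge0// expectation_ge0.
move=> k k1; have [] := factor t0 a0 k1.
set c := _ * _ => c0 tca ca; rewrite mulrA -ca -lee_fin EFinM -(uE (ltW t0)) -(uE (ltW a0)).
rewrite -expectationZl; last exact: Lfun21 (first_passage_Lfun2 stD (ltW a0)).
apply: stochastic_order_expectation_le => //.
- exact: measurable_funM.
- by move=> w /=; rewrite mulr_ge0 ?powR_ge0.
- move=> r r0; apply: le_trans (passage_le c0 t0 a0 tca r0) _.
  by rewrite le_eqVlt; apply/orP; left; apply/eqP; congr (P _); apply/seteqP; split=> w /=; rewrite mulrC.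
Qed.

Let lt_sqr (r y : R) : 0 <= r -> 0 <= y -> (r < y * y) = (Num.sqrt r < y).
Proof.
by move=> r0 y0; rewrite -[in LHS](sqr_sqrtr r0) -expr2 ltr_sqr ?nnegrE ?sqrtr_ge0.
Qed.

Let moment2_le t a : 0 < t -> 0 < a -> q t <= ((t / a) `^ alpha) ^+ 2 * q a.
Proof.
move=> t0 a0; apply: le_of_factor.
  rewrite mulr_ge0 ?exprn_ge0 ?powR_ge0// fine_ge0// expectation_ge0//.
  by move=> w /=; rewrite mulr_ge0.
move=> k k1.
(* k is split evenly between the two factors *)
have sk1 : 1 < Num.sqrt k by rewrite -sqrtr1 ltr_sqrt// (lt_trans ltr01).
have k0 : 0 <= k by rewrite ltW// (lt_trans ltr01).
have [] := factor t0 a0 sk1.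
set c := _ * _ => c0 tca ca.
rewrite mulrA -[X in X * _ * _](sqr_sqrtr k0) -exprMn -ca.
rewrite -lee_fin EFinM -(qE (ltW t0)) -(qE (ltW a0)).
have YY : Y a \* Y a \in Lfun P 1.
  by apply: Lfun2_mul_Lfun1; apply: (first_passage_Lfun2 stD); exact: ltW.
rewrite -expectationZl//.
have Zge0 w : 0 <= c `^ alpha * Y a w by rewrite mulr_ge0 ?powR_ge0.
apply: stochastic_order_expectation_le.
- exact: measurable_funM.
- by apply: measurable_funM => //; exact: measurable_funM.
- by move=> w /=; rewrite mulr_ge0.
- by move=> w /=; rewrite mulr_ge0 ?exprn_ge0 ?powR_ge0// mulr_ge0.
move=> r r0; have sr0 := sqrtr_ge0 r.
rewrite [X in (P X <= _)%E](_ : _ = [set w | Num.sqrt r < Y t w]); last first.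
  by apply/seteqP; split=> w /=; rewrite lt_sqr.
rewrite [X in (_ <= P X)%E](_ : _ = [set w | Num.sqrt r < c `^ alpha * Y a w]).
  exact: passage_le.
apply/seteqP; split=> w /=; rewrite -lt_sqr//; congr (_ < _); ring.
Qed.

Lemma first_passage_mean t : 0 < t -> u t = u 1 * t `^ alpha.
Proof.
move=> t0; apply/le_anti/andP; split.
  by have := mean_le t0 ltr01; rewrite divr1 mulrC.
have := mean_le ltr01 t0; rewrite div1r powRV// mulrC.
by rewrite ler_pdivlMr// powR_gt0.
Qed.

Lemma first_passage_moment2 t : 0 < t -> q t = q 1 * (t `^ alpha) ^+ 2.
Proof.
move=> t0; apply/le_anti/andP; split.
  by have := moment2_le t0 ltr01; rewrite divr1 mulrC.
have := moment2_le ltr01 t0; rewrite div1r powRV// exprVn mulrC.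
by rewrite ler_pdivlMr// exprn_gt0// powR_gt0.
Qed.

End self_similarity.

(** * Asymptotic covariance of the passage times *)

Section power_limits.
Context {R : realType}.

Lemma powRN_cvg0 (b : R) : 0 < b -> t `^ (- b) @[t --> +oo] --> 0.
Proof.
move=> b0; apply/cvgrPdist_lt => e e0; near=> t.
have M0 : 0 < e `^ (- b^-1) by rewrite powR_gt0.
have tM : e `^ (- b^-1) < t by near: t; exact: nbhs_pinfty_gt.
rewrite sub0r normrN ger0_norm ?powR_ge0// powRN.
have := gt0_ltr_powR b0 _ _ tM; rewrite !nnegrE.
move=> /(_ (ltW M0) (ltW (lt_trans M0 tM))).
rewrite -powRrM mulNr mulVf ?gt_eqF// powR_inv1 ?ltW//.
by move=> H; rewrite invf_plt ?posrE ?powR_gt0// (lt_trans M0).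
Unshelve. all: by end_near. Qed.

(** With x = (t - s) / t, the increment is t^a (1 - x^a) <= t^a (1 - x), which
    is s t^(a - 1). *)
Lemma powR_increment_cvg0 (a s : R) : 0 < a < 1 -> 0 <= s ->
  t `^ a - (t - s) `^ a @[t --> +oo] --> 0.
Proof.
move=> /andP[a0 a1] s0.
apply: (@squeeze_cvgr _ _ _ _ (fun=> 0) (fun t => s * t `^ (- (1 - a)))).
- near=> t.
  have st : s < t by near: t; apply: nbhs_pinfty_gt; exact: num_real.
  have t0 : 0 < t by exact: le_lt_trans st.
  have x01 : 0 < (t - s) / t <= 1.
    by rewrite divr_gt0 ?subr_gt0//= ler_pdivrMr// mul1r gerBl.
  have -> : (t - s) `^ a = t `^ a * ((t - s) / t) `^ a.
    have x0 : 0 <= (t - s) / t by case/andP: x01 => /ltW.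
    by rewrite -powRM ?(ltW t0)// mulrCA divff ?mulr1// gt_eqF.
  have -> : s * t `^ (- (1 - a)) = t `^ a * (1 - (t - s) / t).
    rewrite opprB powRB; last by rewrite (gt_eqF t0) implybT.
    rewrite powRr1 ?(ltW t0)//.
    by field; rewrite gt_eqF.
  rewrite -[X in X - _]mulr1 -mulrBr; apply/andP; split.
    rewrite mulr_ge0 ?powR_ge0// subr_ge0.
    have p1 : 1 = 1 `^ a :> R by rewrite powR1.
    case/andP: x01 => x0 x1; rewrite [leRHS]p1.
    by rewrite ge0_ler_powR ?nnegrE ?(ltW x0) ?(ltW a0).
  by rewrite ler_wpM2l ?powR_ge0// lerD2l lerN2 ger1_powR// ltW.
- exact: cvg_cst.
- rewrite -[X in _ --> X](mulr0 s); apply: cvgM; first exact: cvg_cst.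
  by apply: powRN_cvg0; rewrite subr_gt0.
Unshelve. all: by end_near. Qed.

End power_limits.

Section first_passage_covariance.
Context {R : realType} {d : measure_display} {T : measurableType d}.
Variables (P : probability T R) (D : R -> T -> R) (alpha : R).
Hypothesis stD : stable_subordinator P alpha D.
Hypothesis alpha01 : 0 < alpha < 1.

Let subD : subordinator P D. Proof. by case: stD. Qed.
Let alpha0 : 0 < alpha. Proof. by case/andP: alpha01. Qed.
Let Y := first_passage D.
Let mY t : measurable_fun setT (Y t) := measurable_first_passage subD t.
Let Y0 t w : 0 <= Y t w := first_passage_ge0 D t w.
Let Y2 t : 0 <= t -> Y t \in Lfun P 2%:E := @first_passage_Lfun2 _ _ _ _ _ _ stD t.

Let u t := fine 'E_P[Y t]%E.
Let q s t := fine 'E_P[Y s \* Y t]%E.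

Let u0 t : 0 <= u t.
Proof. by rewrite fine_ge0// expectation_ge0. Qed.

Let covE s t : 0 <= s -> 0 <= t ->
  covariance P (Y s) (Y t) = (q s t - u s * u t)%:E.
Proof.
move=> s0 t0; rewrite Lfun2_covE ?Y2//.
rewrite (Lfun1_EFin (Lfun2_mul_Lfun1 (Y2 s0) (Y2 t0))).
by rewrite (Lfun1_EFin (Lfun21 (Y2 s0))) (Lfun1_EFin (Lfun21 (Y2 t0))).
Qed.

(* lets the mesh of the grid tend to 0 *)
Let le_of_small (a b c : R) :
  (forall e, 0 < e -> e < 1 -> a <= b + e * c) -> a <= b.
Proof.
move=> H; apply/ler_addgt0Pr => e e0.
pose c' := Num.max c 1.
have c'1 : 1 <= c' by rewrite le_max lexx orbT.
have cc' : c <= c' by rewrite le_max lexx.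
have c'0 : 0 < c' by lra.
pose e' := Num.min (e / c') 2^-1.
have e'0 : 0 < e' by rewrite lt_min divr_gt0//= invr_gt0.
have e'1 : e' < 1 by rewrite gt_min orbC invf_lt1// ltr1n.
apply: le_trans (H _ e'0 e'1) _; rewrite lerD2l.
apply: (@le_trans _ _ (e' * c')); first by rewrite ler_pM2l.
by rewrite -ler_pdivlMr// ge_min lexx.
Qed.

Lemma first_passage_covariance_le s t : 0 <= s -> s <= t ->
  q s t - u s * u t <= q s s / 2.
Proof.
move=> s0 st; apply: (@le_of_small _ _ (u s / 2 + u s + u t + 1)) => e e0 e1.
have H : q s t <= (q s s + e * u s) / 2 + (u t + e) * (u s + e).
  exact: moment_product_le stD _ e0 _ _ s0 st.
have ee : e * e <= e by rewrite -[leRHS]mulr1 ler_pM2l// ltW.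
by move: (q s t) (q s s) (u s) (u t) H => x y z t'; lra.
Qed.

Lemma first_passage_covariance_ge s t : 0 <= s -> s <= t ->
  q s s / 2 - u s * (u t - u (t - s)) <= q s t - u s * u t.
Proof.
move=> s0 st; apply: (@le_of_small _ _ (u s / 2 + u s + u t + 1)) => e e0 e1.
have H : q s s / 2 + u (t - s) * u s <=
    q s t + e * (u s + u t) + e * e + e / 2 * u s.
  exact: moment_product_ge stD _ e0 _ _ s0 st.
have ee : e * e <= e by rewrite -[leRHS]mulr1 ler_pM2l// ltW.
by move: (q s t) (q s s) (u s) (u t) (u (t - s)) H => x y z t' z'; lra.
Qed.

Lemma first_passage_covariance_cvg s : 0 < s ->
  q s t - u s * u t @[t --> +oo] --> q s s / 2.
Proof.
move=> s0.
apply: (@squeeze_cvgr _ _ _ _ (fun t => q s s / 2 -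
  u s * (u 1 * (t `^ alpha - (t - s) `^ alpha))) (fun=> q s s / 2)).
- near=> t.
  have st : s < t by near: t; apply: nbhs_pinfty_gt; exact: num_real.
  apply/andP; split; last by apply: first_passage_covariance_le; exact: ltW.
  have t0 : 0 < t := lt_trans s0 st.
  have ut : u t = u 1 * t `^ alpha := first_passage_mean stD alpha0 t0.
  have uts : u (t - s) = u 1 * (t - s) `^ alpha.
    by apply: (first_passage_mean stD alpha0); rewrite subr_gt0.
  rewrite mulrBr -ut -uts.
  exact: first_passage_covariance_ge (ltW s0) (ltW st).
- rewrite -[X in _ --> X]subr0; apply: cvgB; first exact: cvg_cst.
  rewrite -[X in _ --> X](mulr0 (u s)); apply: cvgM; first exact: cvg_cst.
  rewrite -[X in _ --> X](mulr0 (u 1)); apply: cvgM; first exact: cvg_cst.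
  by apply: powR_increment_cvg0 => //; exact: ltW.
- exact: cvg_cst.
Unshelve. all: by end_near. Qed.

(** Y_t >= t / 2 on the event D (t / 2) <= t, whose probability is at least
    e^(- t / 2) - e^(- t) by [level_lower]. *)
Lemma first_passage_mean_gt0 t : 0 < t -> 0 < u t.
Proof.
move=> t0; rewrite lt0r u0 andbT; apply/eqP => ut0.
pose r := t / 2; have [r0 rt] : 0 < r /\ r < t by rewrite /r; split; lra.
have pos : (0 < P [set w | (D r w <= t)%R])%E.
  have := level_lower stD t (ltW r0); rewrite -leeBlDr//.
  by apply: lt_le_trans; rewrite -EFinB lte_fin subr_gt0 ltr_expR ltrN2.
have : (r%:E * P [set w | (D r w <= t)%R] <= 'E_P[Y t])%E.
  have mDr : measurable [set w | D r w <= t].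
    exact: measurable_le_level subD _ _ (ltW r0).
  rewrite -(expectation_indic P mDr) -expectationZl; last exact: Lfun1_indic.
  apply: expectation_le => //.
  - by apply: measurable_funM => //; exact: measurable_indic.
  - by move=> w; rewrite /= mulr_ge0// ltW.
  have := ae_crosses stD t; apply: filterS => w cw /=; rewrite indicE.
  have [Dw|Dw] := pselect (D r w <= t).
    by rewrite mem_set//= mul1r; apply: (le_first_passage subD (ltW r0) cw).
  by rewrite memNset//= mul0r.
rewrite (Lfun1_EFin (Lfun21 (Y2 (ltW t0)))) -/(u t) ut0.
by rewrite leNgt mule_gt0// lte_fin.
Qed.

(** If Y_t had variance 0, then by the Cauchy-Schwarz inequality Cov (Y_t, Y_t')
    would be at most 0 for all t', although it tends to E Y_t^2 / 2 > 0 as t'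
    grows. *)
Lemma first_passage_variance_gt0 t : 0 < t -> u t * u t < q t t.
Proof.
move=> t0.
have qu s : 0 <= s -> u s * u s <= q s s.
  by move=> s0; rewrite -subr_ge0 -lee_fin -covE//; exact: variance_ge0.
rewrite lt_neqAle qu ?ltW// andbT; apply/eqP => qu0.
have q0 : 0 < q t t by rewrite -qu0 mulr_gt0 ?first_passage_mean_gt0.
have : q t t / 2 <= 0.
  apply: (cvgr_to_le (first_passage_covariance_cvg t0)); near=> t'.
  have t'0 : 0 <= t'.
    by apply/ltW; near: t'; apply: nbhs_pinfty_gt; exact: num_real.
  rewrite -lee_fin -(covE (ltW t0) t'0).
  apply: le_trans (covariance_le (Y2 (ltW t0)) (Y2 t'0)) _.
  have -> : 'V_P[Y t]%E = 0%E by rewrite /variance (covE (ltW t0) (ltW t0)) -qu0 subrr.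
  by rewrite sqrte0 mul0e.
lra.
Unshelve. all: by end_near. Qed.

End first_passage_covariance.

(** * Long-range dependence *)

Section long_range_dependence.
Context {R : realType} {d : measure_display} {T : measurableType d}.
Variable P : probability T R.

(** If Var Z_t grows like L t^(2 gamma) while the covariances with Z_s converge
    to a positive limit, the correlations decay like t^(- gamma). *)
Lemma LRD_of_asymptotics (Z : R -> T -> R) (gamma L : R) (C : R -> R) :
  (forall t, 0 <= t -> Z t \in Lfun P 2%:E) ->
  0 < gamma < 1 -> 0 < L -> (forall s, 0 < s -> 0 < C s) ->
  (forall s, 0 < s -> 0 < fine 'V_P[Z s]%E) ->
  (forall s, 0 < s -> fine (covariance P (Z s) (Z t)) @[t --> +oo] --> C s) ->
  fine 'V_P[Z t]%E * (t `^ (- gamma)) ^+ 2 @[t --> +oo] --> L ->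
  LRD P Z.
Proof.
move=> Z2 g01 L0 C0 V0 covC varL; split=> //; exists gamma => //.
exists (fun s => C s / (Num.sqrt (fine 'V_P[Z s]%E) * Num.sqrt L)) => s s0.
have D0 : Num.sqrt (fine 'V_P[Z s]%E) * Num.sqrt L != 0.
  by rewrite gt_eqF// mulr_gt0// sqrtr_gt0// V0.
split; first by rewrite gt_eqF// divr_gt0 ?C0// mulr_gt0 ?sqrtr_gt0// V0.
have -> : (fun t => fine (covariance P (Z s) (Z t)) /
    (Num.sqrt (fine 'V_P[Z s]%E) * Num.sqrt (fine 'V_P[Z t]%E) * t `^ (- gamma))) =
  (fun t => fine (covariance P (Z s) (Z t)) / (Num.sqrt (fine 'V_P[Z s]%E) *
    Num.sqrt (fine 'V_P[Z t]%E * (t `^ (- gamma)) ^+ 2))).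
  apply/funext => t; rewrite sqrtrM ?fine_ge0 ?variance_ge0//.
  by rewrite sqrtr_sqr ger0_norm ?powR_ge0// mulrA.
apply: cvgM; first exact: covC.
apply: cvgV => //; apply: cvgM; first exact: cvg_cst.
apply: continuous_cvg => //; exact: sqrt_continuous.
Qed.

Section subordinated_levy.
Variables (S D : R -> T -> R) (alpha m v : R) (Z : R -> T -> R).
Hypothesis Smv : levy_moments P S m v.
Hypothesis rcS : forall w t, 0 <= t -> S r w @[r --> t^'+] --> S t w.
Hypothesis stD : stable_subordinator P alpha D.
Hypothesis YS : independent_processes P (first_passage D) S.
Hypothesis ZS : forall t w, 0 <= t -> Z t w = S (first_passage D t w) w.

Let subD : subordinator P D. Proof. by case: stD. Qed.
Let Y := first_passage D.
Let mY t : measurable_fun setT (Y t) := measurable_first_passage subD t.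
Let Y0 t w : 0 <= Y t w := first_passage_ge0 D t w.
Let Y2 t : 0 <= t -> Y t \in Lfun P 2%:E := @first_passage_Lfun2 _ _ _ _ _ _ stD t.

Let U := sigma_space [set t : R | 0 <= t] S.
Let S' (a : R) (x : U) : R := S (Num.max a 0) x.

Let mU : measurable_fun [set: T] (id : T -> U).
Proof.
apply: measurable_to_sigma_space => t t0; have [S2 _ _] := Smv.
exact: Lfun_measurable (S2 t t0).
Qed.

Let mS' : measurable_fun [set: R * U] (fun z => S' z.1 z.2).
Proof.
apply: (@measurable_right_continuous _ _ U (S : R -> U -> R)) => [t t0|w t t0].
  exact: measurable_sigma_space.
exact: rcS.
Qed.

Let S'_mean a : 0 <= a -> 'E_P[S' a \o id]%E = (m * a)%:E.
Proof.
move=> a0; have [_ Sm _] := Smv; rewrite -Sm//; congr ('E_P[_])%E.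
by apply/funext => w; rewrite /S' /= max_l.
Qed.

Let S'_moment2 a b : 0 <= a -> 0 <= b -> a <= b ->
  'E_P[(S' a \o id) \* (S' b \o id)]%E = (v * a + m ^+ 2 * (a * b))%:E.
Proof.
move=> a0 b0 ab; rewrite -(levy_moment2 Smv a0 ab); congr ('E_P[_])%E.
by apply/funext => w; rewrite /S' /= !max_l.
Qed.

Let YS_indep s t : 0 <= s -> 0 <= t ->
  independent_maps P (fun w => (Y s w, Y t w)) (id : T -> U).
Proof.
move=> s0 t0 A B mA mB; apply: YS => //.
have := @measurable_fun_pair _ _ _ (sigma_space [set t : R | 0 <= t] Y) _ _ _ _
  (measurable_sigma_space (D := [set t : R | 0 <= t]) (i := s) Y s0)
  (measurable_sigma_space (D := [set t : R | 0 <= t]) (i := t) Y t0).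
by move=> /(_ measurableT A mA); rewrite setTI.
Qed.

Let Y_le s t : s <= t -> {ae P, forall w, Y s w <= Y t w}.
Proof.
move=> st; have := ae_crosses stD t; apply: filterS => w.
exact: first_passage_mono.
Qed.

Let ZE t : 0 <= t -> Z t = (fun w => S' (Y t w) w).
Proof. by move=> t0; apply/funext => w; rewrite ZS// /S' max_l. Qed.

Lemma subordinated_Lfun2 t : 0 <= t -> Z t \in Lfun P 2%:E.
Proof.
move=> t0; rewrite ZE//.
have [] := subordination_Lfun2 mU mS' (time := id : R -> R) (dom := [set a : R | 0 <= a])
  S'_moment2 (mY t) (mY t) (Y0 t) (Y0 t) (Y2 t0) (Y2 t0) (YS_indep t0 t0).
by [].
Qed.

Lemma subordinated_covariance s t : 0 <= s -> s <= t ->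
  covariance P (Z s) (Z t) =
  (v%:E * 'E_P[Y s] + (m ^+ 2)%:E * covariance P (Y s) (Y t))%E.
Proof.
move=> s0 st; have t0 := le_trans s0 st; rewrite !ZE//.
have := subordination_covariance mU (@measurable_id _ R setT) mS'
  (dom := [set a : R | 0 <= a]) S'_mean S'_moment2 (mY s) (mY t) (Y0 s) (Y0 t)
  (Y_le st) (Y2 s0) (Y2 t0) (YS_indep s0 t0).
by [].
Qed.

End subordinated_levy.

(** The correlation of S_s and S_t is (s / t)^(1/2) for s <= t. *)
Lemma levy_LRD (S : R -> T -> R) m v : 0 < v -> levy_moments P S m v -> LRD P S.
Proof.
move=> v0 [S2 Sm Sc].
have var t : 0 <= t -> fine 'V_P[S t]%E = v * t.
  by move=> t0; rewrite /variance Sc.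
apply: (@LRD_of_asymptotics S 2^-1 v (fun s => v * s)) => //.
- by apply/andP; split; lra.
- by move=> s s0; rewrite mulr_gt0.
- by move=> s s0; rewrite var ?mulr_gt0// ltW.
- move=> s s0; apply: cvg_near_cst; near=> t.
  by rewrite Sc ?ltW//; near: t; apply: nbhs_pinfty_gt; exact: num_real.
- apply: cvg_near_cst; near=> t.
  have t0 : 0 < t by near: t; apply: nbhs_pinfty_gt; exact: num_real.
  rewrite var ?ltW// powRN exprVn -powR_mulrn ?powR_ge0// -powRrM mulVf// powRr1 ?ltW//.
  by rewrite mulfK// gt_eqF.
Unshelve. all: by end_near. Qed.

(** The variance of Z_t is A t^alpha + m^2 B t^(2 alpha) with [A] and [B]
    positive, so that its order depends on whether [m] vanishes. *)
Lemma subordinated_LRD S D alpha m v Z : 0 < alpha < 1 -> 0 < v ->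
  levy_moments P S m v ->
  (forall w t, 0 <= t -> S r w @[r --> t^'+] --> S t w) ->
  stable_subordinator P alpha D ->
  independent_processes P (first_passage D) S ->
  (forall t w, 0 <= t -> Z t w = S (first_passage D t w) w) ->
  LRD P Z.
Proof.
move=> a01 v0 Smv rcS stD YS ZS; have /andP[a0 a1] := a01.
pose u t := fine 'E_P[first_passage D t]%E.
pose q s t := fine 'E_P[first_passage D s \* first_passage D t]%E.
have u_gt0 t : 0 < t -> 0 < u t := first_passage_mean_gt0 stD (t := t).
have Y2 t := @first_passage_Lfun2 _ _ _ _ _ _ stD t.
have cov s t : 0 <= s -> s <= t ->
    fine (covariance P (Z s) (Z t)) = v * u s + m ^+ 2 * (q s t - u s * u t).
  move=> s0 st; have t0 := le_trans s0 st.
  rewrite (subordinated_covariance Smv rcS stD YS ZS s0 st) Lfun2_covE ?Y2//.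
  rewrite (Lfun1_EFin (Lfun2_mul_Lfun1 (Y2 _ s0) (Y2 _ t0))).
  by rewrite (Lfun1_EFin (Lfun21 (Y2 _ s0))) (Lfun1_EFin (Lfun21 (Y2 _ t0))).
have var_ge t : 0 <= t -> 0 <= q t t - u t * u t.
  move=> t0; have := variance_ge0 P (first_passage D t).
  rewrite /variance Lfun2_covE ?Y2//.
  rewrite (Lfun1_EFin (Lfun2_mul_Lfun1 (Y2 _ t0) (Y2 _ t0))).
  by rewrite (Lfun1_EFin (Lfun21 (Y2 _ t0))) lee_fin.
have q_ge0 t : 0 <= q t t.
  by rewrite fine_ge0// expectation_ge0// => w; rewrite /= mulr_ge0 ?first_passage_ge0.
have covC s : 0 < s -> fine (covariance P (Z s) (Z t)) @[t --> +oo] -->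
    v * u s + m ^+ 2 * (q s s / 2).
  move=> s0.
  have : v * u s + m ^+ 2 * (q s t - u s * u t) @[t --> +oo] -->
      v * u s + m ^+ 2 * (q s s / 2).
    apply: cvgD; first exact: cvg_cst.
    apply: cvgM; first exact: cvg_cst.
    exact: (first_passage_covariance_cvg stD a01 s0).
  apply: cvg_trans; apply: near_eq_cvg; near=> t.
  by rewrite cov ?ltW//; near: t; apply: nbhs_pinfty_gt; exact: num_real.
have var t : 0 < t -> fine 'V_P[Z t]%E =
    v * u 1 * t `^ alpha + m ^+ 2 * (q 1 1 - u 1 * u 1) * (t `^ alpha) ^+ 2.
  move=> t0; rewrite /variance (cov t t (ltW t0) (lexx t)).
  rewrite /u /q (first_passage_mean stD a0 t0) (first_passage_moment2 stD a0 t0).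
  ring.
have C0 s : 0 < s -> 0 < v * u s + m ^+ 2 * (q s s / 2).
  move=> s0; apply: ltr_pwDl; first by rewrite mulr_gt0// u_gt0.
  by rewrite mulr_ge0 ?sqr_ge0// divr_ge0// q_ge0.
have V0 s : 0 < s -> 0 < fine 'V_P[Z s]%E.
  move=> s0; rewrite /variance (cov s s (ltW s0) (lexx s)).
  apply: ltr_pwDl; first by rewrite mulr_gt0// u_gt0.
  by rewrite mulr_ge0 ?sqr_ge0// var_ge// ltW.
have Z2 t : 0 <= t -> Z t \in Lfun P 2%:E := subordinated_Lfun2 Smv rcS stD YS ZS (t := t).
have [m0|m0] := eqVneq m 0.
  (* the variance reduces to its term of order t^alpha *)
  apply: (LRD_of_asymptotics (gamma := alpha / 2) (L := v * u 1) Z2 _ _ C0 V0 covC).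
  - by apply/andP; split; lra.
  - by rewrite mulr_gt0// u_gt0.
  apply: cvg_near_cst; near=> t.
  have t0 : 0 < t by near: t; apply: nbhs_pinfty_gt; exact: num_real.
  rewrite var// m0 expr0n/= !mul0r addr0 powRN exprVn.
  rewrite -[in X in _ / X]powR_mulrn ?powR_ge0// -powRrM mulfVK//.
  by rewrite mulfK// gt_eqF// powR_gt0.
have m2 : 0 < m ^+ 2 by rewrite lt0r sqr_ge0 andbT expf_neq0.
apply: (LRD_of_asymptotics (gamma := alpha)
  (L := m ^+ 2 * (q 1 1 - u 1 * u 1)) Z2 a01 _ C0 V0 covC).
  by rewrite mulr_gt0// subr_gt0 (first_passage_variance_gt0 stD a01).
have : v * u 1 * t `^ (- alpha) + m ^+ 2 * (q 1 1 - u 1 * u 1) @[t --> +oo] -->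
    v * u 1 * 0 + m ^+ 2 * (q 1 1 - u 1 * u 1).
  apply: cvgD; last exact: cvg_cst.
  by apply: cvgM; [exact: cvg_cst|exact: powRN_cvg0].
rewrite mulr0 add0r; apply: cvg_trans; apply: near_eq_cvg; near=> t.
have t0 : 0 < t by near: t; apply: nbhs_pinfty_gt; exact: num_real.
rewrite var// powRN; field; rewrite gt_eqF// powR_gt0//.
Unshelve. all: by end_near. Qed.

End long_range_dependence.

Unset Implicit Arguments.

Theorem theorem2p2 (R : realType) (d : measure_display) (T : measurableType d)
    (P : probability T R) (k : nat) (lambda1 lambda2 alpha : R)
    (Z : R -> T -> R) :
  (1 <= k)%N -> 0 < lambda1 -> 0 < lambda2 -> 0 < alpha <= 1 ->
  FSPoK P k lambda1 lambda2 alpha Z ->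
  LRD P Z.
Proof.
move=> k1 l1 l2 _; have v0 : 0 < step_moment k 2 * (k%:R * (lambda1 + lambda2)).
  by rewrite mulr_gt0 ?step_moment2_gt0// mulr_gt0 ?ltr0n// addr_gt0.
case=> [[_ SZ]|[a01 [S [D [SPS stD YS ZS]]]]].
  exact: levy_LRD v0 (SPoK_levy_moments k1 l1 l2 SZ).
apply: (subordinated_LRD a01 v0 (SPoK_levy_moments k1 l1 l2 SPS)) stD YS ZS.
by move=> w t t0; exact: SPoK_right_continuous SPS t0.
Qed.
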